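(* For each $\sigma\in[\sigma_0,\sigma_1]$ one has $\mathfrak n(\sigma)\in\{0,1\}$. Moreover: (1) $\mathfrak n(\sigma)=m^+(\mathfrak a(\sigma))$ if $\mathfrak a(\sigma)\ne0$; (2) $\mathfrak n(\sigma)=1$ if $d\mathcal L_2(x_\sigma,T_\sigma)\neq0$ and $\mathfrak a(\sigma)=0$; (3) $\mathfrak n(\sigma)-m^+(\mathfrak a(\sigma))\ge0$, with equality if $\mathfrak n(\sigma)=0$.
   Context: Fix $x_\pm\in\mathbb R^n$; $W^{1,2}_{x_\pm}([0,1],\mathbb R^n)=\{x\in W^{1,2}([0,1],\mathbb R^n):x(0)=x_-,x(1)=x_+\}$, $W_0^{1,2}=\{\xi\in W^{1,2}([0,1],\mathbb R^n):\xi(0)=\xi(1)=0\}$, $\mathbb R^+=(0,\infty)$. Let $L(\sigma,x,v)=L_1(x,v)+\sigma L_2(x,v)$ be a family of $C^2$ Lagrangians on $\mathbb R^n\times\mathbb R^n$, quadratic in $v$, with $\partial_{vv}L\ge cI_n$, $c>0$ (motivating case: $L_1=\frac12|v|^2+\frac12|\nabla V(x)|^2$, $L_2=-\Delta V(x)$). Put $\mathcal L_i(x,T)=T\int_0^1L_i(x,\dot x/T)\,dt$ for $i=1,2$ and $\mathcal L(\sigma,x,T)=\mathcal L_1(x,T)+\sigma\mathcal L_2(x,T)$; $d,d^2$ denote first and second differentials in $(x,T)$ at fixed $\sigma$. Let $0\le\sigma_0<\sigma_1$ and let $\sigma\mapsto(x_\sigma,T_\sigma)\in W^{1,2}_{x_\pm}\times\mathbb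 R^+$, $\sigma\in[\sigma_0,\sigma_1]$, be a $C^1$ path such that $(x_\sigma,T_\sigma)$ is a critical point of $\mathcal L(\sigma,\cdot,\cdot)$ for each $\sigma$. Define $\mathcal H(\sigma)=\ker d\mathcal L_2(x_\sigma,T_\sigma)\subset W_0^{1,2}\times\mathbb R$, $$\mathcal H^\bot(\sigma)=\{(\xi,b)\in W_0^{1,2}\times\mathbb R:\ d^2\mathcal L(\sigma,x_\sigma,T_\sigma)[(\xi,b),(\eta,d)]=0\ \ \forall(\eta,d)\in\mathcal H(\sigma)\},$$ $$\mathfrak n(\sigma)=m^-\big(d^2\mathcal L(\sigma,x_\sigma,T_\sigma)|_{\mathcal H^\bot(\sigma)}\big)+\dim(\mathcal H(\sigma)\cap\mathcal H^\bot(\sigma))-\dim(\mathcal H(\sigma)\cap\ker d^2\mathcal L(\sigma,x_\sigma,T_\sigma)),$$ and $\mathfrak a(\sigma)=\frac{d}{d\sigma}\mathcal L_2(x_\sigma,T_\sigma)\in\mathbb R$. Here $m^-$ is the negative index of a quadratic form, and for a real number $a$, $m^+(a)=1$ if $a>0$ and $m^+(a)=0$ otherwise. *)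

(* Defs.v *)
From HB Require Import structures.
From mathcomp Require Import all_boot all_order all_algebra.
From mathcomp Require Import all_classical all_reals all_analysis.
From mathcomp Require Import measurable_realfun ring lra.

Set Implicit Arguments.
Unset Strict Implicit.
Unset Printing Implicit Defensive.

Import Order.TTheory GRing.Theory Num.Theory.
Import numFieldNormedType.Exports.

Local Open Scope classical_set_scope.
Local Open Scope ring_scope.

Local Notation mu := (@lebesgue_measure _).

Definition I01 {R : realType} : set R := `[0, 1].

Definition sq_integrable {R : realType} (f : R -> R) : Prop :=
  measurable_fun I01 f /\ mu.-integrable I01 (EFin \o (fun t => f t ^+ 2)).

Definition ip {R : realType} (f g : R -> R) : R :=
  \int[mu]_(t in I01) (f t * g t).

Section sqint_theory.
Context {R : realType}.
Implicit Types f g h : R -> R.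

Lemma measurable_I01 : measurable (@I01 R).
Proof. exact: measurable_itv. Qed.
#[local] Hint Resolve measurable_I01 : core.

Lemma mu_I01 : mu (@I01 R) = 1%:E.
Proof. by rewrite /I01 lebesgue_measure_itv /= lte_fin ltr01 oppr0 adde0. Qed.

Lemma integrable_cst01 (c : R) : mu.-integrable I01 (EFin \o cst c).
Proof.
apply: continuous_compact_integrable; first exact: segment_compact.
by apply: continuous_subspaceT => x; exact: cvg_cst.
Qed.

Lemma integrableZl_EFin (D : set R) (a : R) f : measurable D ->
  mu.-integrable D (EFin \o f) -> mu.-integrable D (EFin \o (fun t => a * f t)).
Proof.
move=> mD fi; rewrite (_ : _ \o _ = fun t => (a%:E * (EFin \o f) t)%E)//.
exact: integrableZl.
Qed.

Lemma sqint_mul f g : sq_integrable f -> sq_integrable g -> mu.-integrable I01 (EFin \o (fun t => f t * g t)).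
Proof.
move=> [mf f2] [mg g2].
have s : mu.-integrable I01 (EFin \o (fun t => f t ^+ 2 + g t ^+ 2)).
  by rewrite (_ : _ \o _ = (EFin \o (fun t => f t ^+ 2)) \+ (EFin \o (fun t => g t ^+ 2)));
    [exact: integrableD|apply/funext => t /=; rewrite EFinD].
apply: le_integrable s => //.
  by apply/measurable_EFinP; exact: measurable_funM.
move=> t _ /=; rewrite lee_fin [leRHS]ger0_norm ?addr_ge0 ?sqr_ge0//.
rewrite ler_norml; have := sqr_ge0 (f t - g t); have := sqr_ge0 (f t + g t).
have := sqr_ge0 (f t); have := sqr_ge0 (g t).
by nra.
Qed.

Lemma sqint_int f : sq_integrable f -> mu.-integrable I01 (EFin \o f).
Proof.
move=> Lf.
have Lc : sq_integrable (cst (1 : R)).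
  by split => //; rewrite (_ : _ \o _ = EFin \o cst 1);
   [exact: integrable_cst01|apply/funext => t /=; rewrite expr1n].
have := sqint_mul Lf Lc.
by congr (mu.-integrable _ _); apply/funext => t /=; rewrite mulr1.
Qed.

Lemma sqint_lin (a : R) f g : sq_integrable f -> sq_integrable g -> sq_integrable (fun t => a * f t + g t).
Proof.
move=> Lf Lg; case: (Lf) => mf f2; case: (Lg) => mg g2; split.
  by apply: measurable_funD => //; apply: measurable_funM.
rewrite (_ : _ \o _ = fun t => ((a ^+ 2)%:E * (EFin \o (fun t => (f t ^+ 2)%R)) t +
   ((2 * a)%:E * (EFin \o (fun t => (f t * g t)%R)) t +
    (EFin \o (fun t => (g t ^+ 2)%R)) t))%E).
  apply: integrableD => //; first exact: integrableZl.
  apply: integrableD => //; apply: integrableZl => //; exact: sqint_mul.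
by apply/funext => t /=; rewrite -!EFinM -!EFinD; congr EFin; ring.
Qed.

Lemma sqint_continuous f : {within I01, continuous f} -> sq_integrable f.
Proof.
move=> cf; split; first exact: subspace_continuous_measurable_fun.
apply: continuous_compact_integrable; first exact: segment_compact.
by move=> x; apply: cvgM; exact: cf.
Qed.

Lemma ipC f g : ip f g = ip g f.
Proof. by apply: eq_Rintegral => t _; rewrite mulrC. Qed.

Lemma ip_linl (a : R) f g h : sq_integrable f -> sq_integrable g -> sq_integrable h ->
  ip (fun t => a * f t + g t) h = a * ip f h + ip g h.
Proof.
move=> Lf Lg Lh; rewrite /ip -RintegralZl//; last exact: sqint_mul.
rewrite -RintegralD//; last 2 first.
- by apply: integrableZl_EFin => //; exact: sqint_mul.
- exact: sqint_mul.
by apply: eq_Rintegral => t _; ring.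
Qed.

Lemma ip_ge0 f : 0 <= ip f f.
Proof. by apply: Rintegral_ge0 => t _; rewrite -expr2 sqr_ge0. Qed.

Lemma ip_ae f g h : sq_integrable f -> sq_integrable g -> sq_integrable h ->
  ae_eq mu I01 f g -> ip f h = ip g h.
Proof.
move=> Lf Lg Lh fg; congr fine; apply: ae_eq_integral => //.
- by have /integrableP[] := sqint_mul Lf Lh.
- by have /integrableP[] := sqint_mul Lg Lh.
by apply: filterS fg => t e It; rewrite e.
Qed.

Lemma ip_eq0 f : sq_integrable f -> ip f f = 0 -> ae_eq mu I01 f (cst 0).
Proof.
move=> Lf; rewrite /ip /Rintegral => f0.
have fi := sqint_mul Lf Lf.
have {f0} : (\int[mu]_(t in I01) `|(f t * f t)%:E| = 0)%E.
  transitivity (\int[mu]_(t in I01) (f t * f t)%:E)%E.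
    by apply: eq_integral => t _; rewrite gee0_abs// lee_fin -expr2 sqr_ge0.
  by rewrite -[LHS]fineK ?f0//; exact: integrable_fin_num.
move/ae_eq_integral_abs => h.
have {h} := h measurable_I01 (proj1 (integrableP _ _ _ fi)).
apply: filterS => t /= h It; have [/eqP] := h It.
by rewrite mulf_eq0 orbb => /eqP.
Qed.

Lemma ip_cst (c : R) : ip (cst c) (cst c) = c * c.
Proof.
transitivity (\int[mu]_(t in I01) cst (c * c) t); first exact: eq_Rintegral.
rewrite Rintegral_cst// (_ : fine _ = 1) ?mulr1//.
by rewrite (_ : 1 = fine (1%:E : \bar R))//; congr fine; exact: mu_I01.
Qed.

Lemma ae_eq_of_primitive f : mu.-integrable I01 (EFin \o f) ->
  (forall t, I01 t -> \int[mu]_(s in `[0, t]) f s = 0) -> ae_eq mu I01 f (cst 0).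
Proof.
move=> fi f0.
pose g := f \_ I01.
have gi : mu.-integrable setT (EFin \o g).
  by move: fi; rewrite integrable_mkcond// restrict_EFin.
have G0 x : \int[mu]_(s in `]-oo, x]) g s = 0.
  rewrite /g -Rintegral_mkcondr.
  have [x0|x0] := ltP x 0.
    rewrite (_ : _ `&` _ = set0) ?Rintegral_set0//.
    by apply/seteqP; split => // t /=; rewrite /I01 /= !in_itv /= => -[] ; lra.
  rewrite (_ : _ `&` _ = [set` `[0, Num.min x 1]]).
    by apply: f0; rewrite /I01 /= in_itv /= le_min x0 ler01 ge_min lexx orbT.
  apply/seteqP; split => t /=; rewrite /I01 /= !in_itv /= le_min.
    by move=> [-> /andP[-> ->]].
  by move=> /and3P[-> -> ->].
have gl : locally_integrable setT g by exact: integrable_locally.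
have giy y : mu.-integrable `]-oo, y] (EFin \o g).
  by apply: integrableS gi.
have := FTC1Ny giy gl.
apply: filterS; first exact: (ae_filter_ringOfSetsType mu).
move=> t /= [_] + It; rewrite (_ : (fun x => _) = cst 0); last exact/funext.
by rewrite derive1_cst /g patchE mem_set.
Qed.

End sqint_theory.

Section Sobolev.
Context {R : realType} {n : nat}.
Implicit Types v w : R -> 'rV[R]_n.

(* x is absolutely continuous on [0, 1] with derivative v in L^2. *)
Definition is_weak_derivative (x : R -> 'rV[R]_n) v : Prop :=
  (forall i, sq_integrable (fun t => v t 0 i)) /\
  (forall i t, I01 t ->
    x t 0 i = x 0 0 i + \int[mu]_(s in `[0, t]) v s 0 i).

(* An element of W^{1,2}([0, 1], R^n) is represented by its absolutely
   continuous representative, extended by 0 outside [0, 1] so that Leibniz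
   equality of representatives is equality in W^{1,2}. *)
Definition is_W12 (x : R -> 'rV[R]_n) : Prop :=
  (exists v, is_weak_derivative x v) /\ (forall t, ~ I01 t -> x t = 0).

Definition W12pred : {pred R -> 'rV[R]_n} := fun x => `[< is_W12 x >].

Lemma integrable_I0t (f : R -> R) t : I01 t -> sq_integrable f ->
  mu.-integrable `[0, t] (EFin \o f).
Proof.
rewrite /I01 /= in_itv /= => /andP[_ t1] /sqint_int; apply: integrableS => //.
- exact: measurable_itv.
- by move=> s; rewrite /I01 /= !in_itv /= => /andP[-> st]; exact: le_trans st t1.
Qed.

Lemma weak_derivative_lin (a : R) (x y : R -> 'rV[R]_n) v w :
  is_weak_derivative x v -> is_weak_derivative y w ->
  is_weak_derivative (a *: x + y) (a *: v + w).
Proof.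
move=> [Lv xv] [Lw yw]; split=> [i|i t It].
  rewrite (_ : (fun t => _) = fun t => a * v t 0 i + w t 0 i).
    exact: sqint_lin.
  by apply/funext => t; rewrite [LHS]mxE [X in X + _]mxE.
rewrite [LHS]mxE [X in X + _]mxE [X in _ = X + _]mxE [X in _ = X + _ + _]mxE.
rewrite xv// yw//.
rewrite (_ : \int[mu]_(s in `[0, t]) ((a *: v + w) s 0 i) =
   \int[mu]_(s in `[0, t]) (a * v s 0 i + w s 0 i)); last first.
  by apply: eq_Rintegral => s _; rewrite [LHS]mxE [X in X + _]mxE.
have iv := integrable_I0t It (Lv i); have iw := integrable_I0t It (Lw i).
rewrite RintegralD//; last exact: integrableZl_EFin.
by rewrite RintegralZl//; ring.
Qed.

Lemma W12_submod_closed : submod_closed W12pred.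
Proof.
split=> [|a x y /asboolP[[v xv] x0] /asboolP[[w yw] y0]]; apply/asboolP; split.
- exists 0; split=> [i|i t _].
    apply: (@sqint_continuous _ _) => //.
    rewrite (_ : (fun t => _) = cst 0); last by apply/funext => t; rewrite [LHS]mxE.
    by apply: continuous_subspaceT => t; exact: cvg_cst.
  rewrite [LHS]mxE [X in _ = X + _]mxE add0r (_ : \int[mu]_(s in _) _ = \int[mu]_(s in `[0, t]) cst 0 s).
    by rewrite Rintegral_cst// mul0r.
  by apply: eq_Rintegral => s _; rewrite [LHS]mxE.
- by [].
- by exists (a *: v + w); exact: weak_derivative_lin.
- move=> t It; transitivity (a *: x t + y t) => //.
  by rewrite x0// y0// scaler0 addr0.
Qed.

HB.instance Definition _ := GRing.isSubmodClosed.Build R (R -> 'rV[R]_n) W12pred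
  W12_submod_closed.

Record W12 := MkW12 { W12fun :> R -> 'rV[R]_n; W12fun_in : W12fun \in W12pred }.

HB.instance Definition _ := [isSub for W12fun].
HB.instance Definition _ := [Choice of W12 by <:].
HB.instance Definition _ := [SubChoice_isSubLmodule of W12 by <:].

Lemma weak_derivative_ex (x : W12) : exists v, is_weak_derivative x v.
Proof. by have /asboolP[] := W12fun_in x. Qed.

(* A choice of x'; unique up to a null set by [weak_derivative_unique]. *)
Definition weak_derivative (x : W12) : R -> 'rV[R]_n :=
  sval (cid (weak_derivative_ex x)).

Lemma weak_derivativeP (x : W12) : is_weak_derivative x (weak_derivative x).
Proof. exact: (svalP (cid (weak_derivative_ex x))). Qed.

Lemma weak_derivative_unique (x : R -> 'rV[R]_n) v w i :
  is_weak_derivative x v -> is_weak_derivative x w ->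
  ae_eq mu I01 (fun t => v t 0 i) (fun t => w t 0 i).
Proof.
move=> [Lv xv] [Lw xw].
have Ld : sq_integrable (fun t => -1 * w t 0 i + v t 0 i) by exact: sqint_lin.
have d0 t : I01 t -> \int[mu]_(s in `[0, t]) (-1 * w s 0 i + v s 0 i) = 0.
  move=> It.
  have iv := integrable_I0t It (Lv i); have iw := integrable_I0t It (Lw i).
  rewrite RintegralD//; last exact: integrableZl_EFin.
  by rewrite RintegralZl//; have := xv i t It; have := xw i t It; lra.
have := ae_eq_of_primitive (sqint_int Ld) d0.
by apply: filterS => t /= h It; have := h It; lra.
Qed.

Lemma W12_sqint (x : W12) i : sq_integrable (fun t => x t 0 i).
Proof.
apply: sqint_continuous; have [Lv xv] := weak_derivativeP x.
set v := weak_derivative x in Lv xv.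
have c : {within I01, continuous
    (fun t => x 0 0 i + \int[mu]_(s in `[0, t]) v s 0 i)}.
  move=> t; apply: cvgD; first exact: cvg_cst.
  exact: (parameterized_integral_continuous ler01 (sqint_int (Lv i))).
apply: (subspace_eq_continuous _ c) => t; rewrite inE => It /=.
exact/esym/xv.
Qed.

Lemma weak_derivative_sqint (x : W12) i : sq_integrable (fun t => weak_derivative x t 0 i).
Proof. exact: (weak_derivativeP x).1. Qed.

Definition W12norm (x : W12) : R :=
  Num.sqrt (\sum_i (\int[mu]_(t in I01) (x t 0 i ^+ 2) +
    \int[mu]_(t in I01) (weak_derivative x t 0 i ^+ 2))).

Implicit Types x y z : W12.

Let ipW (x y : W12) : R := \sum_i (ip (fun t => x t 0 i) (fun t => y t 0 i) +
  ip (fun t => weak_derivative x t 0 i) (fun t => weak_derivative y t 0 i)).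

Let W12normE x : W12norm x = Num.sqrt (ipW x x).
Proof.
by congr Num.sqrt; apply: eq_bigr => i _; congr (_ + _);
  apply: eq_Rintegral => t _; rewrite expr2.
Qed.

Let ipW_ge0 x : 0 <= ipW x x.
Proof. by apply: sumr_ge0 => i _; rewrite addr_ge0 ?ip_ge0. Qed.

Let ipWC x y : ipW x y = ipW y x.
Proof. by apply: eq_bigr => i _; rewrite ipC [X in _ + X]ipC. Qed.

Let ipW_linl (a : R) x y z : ipW (a *: x + y) z = a * ipW x z + ipW y z.
Proof.
rewrite /ipW mulr_sumr -big_split; apply: eq_bigr => i _ /=.
have Lx := W12_sqint x i; have Ly := W12_sqint y i; have Lz := W12_sqint z i.
have Lx' := weak_derivative_sqint x i; have Ly' := weak_derivative_sqint y i.
have Lz' := weak_derivative_sqint z i; have Lxy' := weak_derivative_sqint (a *: x + y) i.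
rewrite (_ : (fun t => (a *: x + y) t 0 i) = fun t => a * x t 0 i + y t 0 i).
  rewrite (ip_ae (f := fun t => weak_derivative (a *: x + y) t 0 i)
    (g := fun t => a * weak_derivative x t 0 i + weak_derivative y t 0 i))//.
  - by rewrite !ip_linl//; ring.
  - exact: sqint_lin.
  - have := weak_derivative_unique i (weak_derivativeP (a *: x + y))
      (weak_derivative_lin a (weak_derivativeP x) (weak_derivativeP y)).
    apply: filterS => t h It; rewrite h// [LHS]mxE [X in X + _]mxE//.
by apply/funext => t; rewrite [LHS]mxE [X in X + _]mxE.
Qed.

Let ipW_linr (a : R) x y z : ipW z (a *: x + y) = a * ipW z x + ipW z y.
Proof. by rewrite ipWC ipW_linl ipWC (ipWC y). Qed.

Let ipW_sqr (a b : R) x y : ipW (a *: x + b *: y) (a *: x + b *: y) =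
  a ^+ 2 * ipW x x + (2 * a * b * ipW x y + b ^+ 2 * ipW y y).
Proof.
have e z : ipW (b *: y) z = b * ipW y z.
  by have := ipW_linl b y 0 z; have := ipW_linl (-1) 0 0 z;
    rewrite !scaler0 !addr0 => ? ->; lra.
by rewrite ipW_linl !ipW_linr !e ![ipW _ (b *: y)]ipWC !e (ipWC y x); ring.
Qed.

Let ipW_CS x y : ipW x y <= Num.sqrt (ipW x x) * Num.sqrt (ipW y y).
Proof.
set p := Num.sqrt _; set q := Num.sqrt _.
have p2 : p ^+ 2 = ipW x x by rewrite sqr_sqrtr.
have q2 : q ^+ 2 = ipW y y by rewrite sqr_sqrtr.
have p0 : 0 <= p := sqrtr_ge0 _; have q0 : 0 <= q := sqrtr_ge0 _.
have H a b : 0 <= a ^+ 2 * ipW x x + (2 * a * b * ipW x y + b ^+ 2 * ipW y y).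
  by rewrite -ipW_sqr.
have [pq|] := ltP 0 (p * q).
  have := H q (- p); rewrite -p2 -q2.
  rewrite (_ : _ + _ = 2 * (p * q) * (p * q - ipW x y)); last by ring.
  by rewrite pmulr_rge0 ?subr_ge0// mulr_gt0.
move=> pq; have pq0 : p * q = 0 by apply/eqP; rewrite eq_le pq mulr_ge0.
rewrite pq0 leNgt; apply/negP => c0.
move/eqP : pq0; rewrite mulf_eq0 => /orP[] /eqP e.
- have := H (- (ipW y y + 1)) (ipW x y); rewrite -p2 e -q2.
  have := sqr_ge0 q; have := exprn_gt0 2 c0.
  set s := q ^+ 2; set c := ipW x y => h1 h2.
  by rewrite (_ : _ + _ = - c ^+ 2 * (s + 2)); [nra|ring].
- have := H (ipW x y) (- (ipW x x + 1)); rewrite -q2 e -p2.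
  have := sqr_ge0 p; have := exprn_gt0 2 c0.
  set s := p ^+ 2; set c := ipW x y => h1 h2.
  by rewrite (_ : _ + _ = - c ^+ 2 * (s + 2)); [nra|ring].
Qed.

Lemma ler_W12normD x y : W12norm (x + y) <= W12norm x + W12norm y.
Proof.
rewrite !W12normE.
have := sqrtr_ge0 (ipW x x); have := sqrtr_ge0 (ipW y y) => q0 p0.
rewrite -(ger0_norm (addr_ge0 p0 q0)) -sqrtr_sqr ler_wsqrtr//.
have := ipW_sqr 1 1 x y; rewrite !scale1r => ->.
by rewrite sqrrD !sqr_sqrtr//; have := ipW_CS x y; lra.
Qed.

Lemma W12normZ (a : R) x : W12norm (a *: x) = `|a| * W12norm x.
Proof.
rewrite !W12normE; have := ipW_sqr a 0 x 0.
rewrite scaler0 addr0 => ->.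
by rewrite mulr0 expr0n !mul0r !addr0 sqrtrM ?sqr_ge0// sqrtr_sqr.
Qed.

Lemma W12norm0_eq0 x : W12norm x = 0 -> x = 0.
Proof.
rewrite W12normE => /eqP; rewrite sqrtr_eq0 => xx.
have {}xx : ipW x x = 0 by apply/eqP; rewrite eq_le xx ipW_ge0.
apply/val_inj/funext => t /=; have /asboolP[_ xout] := W12fun_in x.
have [It|/xout ->//] := pselect (I01 t).
apply/rowP => i; rewrite [RHS]mxE.
move/eqP: xx; rewrite psumr_eq0; last by move=> j _; rewrite addr_ge0 ?ip_ge0.
move=> /allP/(_ i (mem_index_enum i)) /=; rewrite paddr_eq0 ?ip_ge0//.
move=> /andP[/eqP xi /eqP vi].
have [Lv xv] := weak_derivativeP x.
have x0 s : I01 s -> x s 0 i = x 0 0 i.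
  move=> Is; rewrite xv// -[RHS]addr0; congr (_ + _).
  transitivity (\int[mu]_(u in `[0, s]) cst 0 u); last first.
    by rewrite Rintegral_cst// mul0r.
  congr fine; apply: ae_eq_integral => //.
  - exact: measurable_int (integrable_I0t Is (Lv i)).
  - exact: (@measurable_cst _ _ _ _ _ (0%:E : \bar R)).
  - have := ip_eq0 (Lv i) vi; apply: filterS => u h Iu; congr EFin; apply: h.
    move: Is Iu; rewrite /I01 /= !in_itv /= => /andP[_ s1] /andP[-> us].
    by rewrite (le_trans us s1).
rewrite x0//; move: xi.
rewrite (_ : ip _ _ = ip (cst (x 0 0 i)) (cst (x 0 0 i))).
  by rewrite ip_cst => /eqP; rewrite mulf_eq0 orbb => /eqP.
by apply: eq_Rintegral => s; rewrite inE => Is; rewrite !x0.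
Qed.

HB.instance Definition _ := Lmodule_isNormed.Build R W12
  ler_W12normD W12normZ W12norm0_eq0.

End Sobolev.

Arguments W12 : clear implicits.

Section Smoothness.
Context {R : realType}.

(* For a finite-dimensional V this is the usual C^1: differentiable everywhere,
   with continuous partial derivatives. *)
Definition C1 {V : normedModType R} (f : V -> R) : Prop :=
  (forall p, differentiable f p) /\ (forall h, continuous (fun p => 'd f p h)).

Definition C2 {V : normedModType R} (f : V -> R) : Prop :=
  C1 f /\ forall h, C1 (fun p => 'd f p h).

(* Second differential d^2 F(p)[h, k]. *)
Definition diff2 {V : normedModType R} (F : V -> R) (p h k : V) : R :=
  'd (fun q => 'd F q h) p k.

(* Derivative along D; one-sided at the endpoints when D is a segment. *)
Definition diff_quot_in {V : normedModType R} (D : set R) (f : R -> V) (s : R) :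
    set_system V :=
  (fun t => (t - s)^-1 *: (f t - f s)) @ within D s^'.

Definition derive_in {V : normedModType R} (D : set R) (f : R -> V) (s : R) : V :=
  lim (diff_quot_in D f s).

Definition C1_path {V : normedModType R} (D : set R) (f : R -> V) : Prop :=
  (forall s, D s -> cvg (diff_quot_in D f s)) /\
  {within D, continuous (derive_in D f)}.

End Smoothness.

Section LinearAlgebra.
Context {R : realType} {V : lmodType R}.

Definition lin_indep (k : nat) (u : 'I_k -> V) : Prop :=
  forall a : 'I_k -> R, \sum_i a i *: u i = 0 -> forall i, a i = 0.

Definition is_subspace (W : set V) : Prop :=
  W 0 /\ forall (a : R) u v, W u -> W v -> W (a *: u + v).

Local Open Scope ereal_scope.

Definition lin_dim (W : set V) : \bar R :=
  ereal_sup [set (k%:R)%:E | k in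
    [set k : nat | exists2 u : 'I_k -> V, (forall i, W (u i)) & lin_indep u]].

(* Negative index of the quadratic form Q restricted to W. *)
Definition neg_index (Q : V -> R) (W : set V) : \bar R :=
  ereal_sup [set lin_dim U | U in [set U | [/\ is_subspace U, U `<=` W &
    forall u, U u -> u <> 0%R -> (Q u < 0)%R]]].

End LinearAlgebra.

Section Action.
Context {R : realType} {n : nat}.
Implicit Types (L : 'rV[R]_n -> 'rV[R]_n -> R) (p : W12 R n * R).

(* Polynomial of degree at most 2 in v, with coefficients depending on x. *)
Definition quadratic_in_v L : Prop :=
  exists (A : 'rV[R]_n -> 'M[R]_n) (b : 'rV[R]_n -> 'rV[R]_n)
         (c : 'rV[R]_n -> R),
  forall x v, L x v = (v *m A x *m v^T) 0 0 + (b x *m v^T) 0 0 + c x.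

(* The matrix of second partial derivatives in v. *)
Definition hess_v L (x v : 'rV[R]_n) : 'M[R]_n :=
  \matrix_(i, j) 'D_(delta_mx 0 i) ('D_(delta_mx 0 j) (L x)) v.

(* A >= c I_n in the sense of quadratic forms. *)
Definition mx_ge (A : 'M[R]_n) (c : R) : Prop :=
  forall w : 'rV[R]_n, c * (w *m w^T) 0 0 <= (w *m A *m w^T) 0 0.

Definition pencil (L1 L2 : 'rV[R]_n -> 'rV[R]_n -> R) (sigma : R) :=
  fun x v => L1 x v + sigma * L2 x v.

Definition action_fun L p : R :=
  p.2 * \int[mu]_(t in I01) L (p.1 t) (p.2^-1 *: weak_derivative p.1 t).

Definition action_pencil (L1 L2 : 'rV[R]_n -> 'rV[R]_n -> R) (sigma : R) p : R :=
  action_fun L1 p + sigma * action_fun L2 p.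

Definition W12bd (xm xp : 'rV[R]_n) : set (W12 R n) :=
  [set x | x 0 = xm /\ x 1 = xp].

(* W_0^{1,2} x R, the tangent space of W^{1,2}_{x_-, x_+} x (0, +oo). The
   differentials of the functionals, defined on the whole of W^{1,2} x R, are
   only evaluated on it; on it they are the differentials of the restrictions
   to W^{1,2}_{x_-, x_+} x (0, +oo). *)
Definition variations : set (W12 R n * R) := [set h | W12bd 0 0 h.1].

Definition is_critical (F : W12 R n * R -> R) p : Prop :=
  forall h, variations h -> 'd F p h = 0.

Definition ker_diff (F : W12 R n * R -> R) p : set (W12 R n * R) :=
  [set h | variations h /\ 'd F p h = 0].

Definition ker_diff2 (F : W12 R n * R -> R) p : set (W12 R n * R) :=
  [set h | variations h /\ forall k, variations k -> diff2 F p h k = 0].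

Definition orth_diff2 (F : W12 R n * R -> R) p (H : set (W12 R n * R)) :
    set (W12 R n * R) :=
  [set h | variations h /\ forall k, H k -> diff2 F p h k = 0].

Local Open Scope ereal_scope.

(* In \bar R both +oo - +oo and -oo are different from 0 and 1, so a value 0 or
   1 of [frak_n] entails that the three terms are finite. *)
Definition frak_n (L1 L2 : 'rV[R]_n -> 'rV[R]_n -> R) (sigma : R) p : \bar R :=
  let F := action_pencil L1 L2 sigma in
  let H := ker_diff (action_fun L2) p in
  let Hperp := orth_diff2 F p H in
  neg_index (fun h => diff2 F p h h) Hperp
    + lin_dim (H `&` Hperp) - lin_dim (H `&` ker_diff2 F p).

Definition m_plus (a : R) : \bar R := if (0 < a)%R then 1 else 0.

End Action.

(* Main.v *)
Require Import Defs.
From HB Require Import structures.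
From mathcomp Require Import all_boot all_order all_algebra.
From mathcomp Require Import all_classical all_reals all_analysis.
From mathcomp Require Import measurable_realfun ring lra.

Set Implicit Arguments.
Unset Strict Implicit.
Unset Printing Implicit Defensive.

Import Order.TTheory GRing.Theory Num.Theory.
Import numFieldNormedType.Exports.

Local Open Scope classical_set_scope.
Local Open Scope ring_scope.

(** Write F_s for the action of L1 + s L2, G for the action of L2, p_s for the critical
    points, v for the derivative of s |-> p_s and B for the second differential of F_s
    at p_s on the space X of variations. Differentiating d F_s(p_s) h = 0 in s gives
    B(h, v) = - d G(p_s) h ([critical_path_equation]). Hence the kernel H of d G(p_s)
    is the B-orthogonal of v, and a = d G(p_s) v = - B(v, v).

    The rest is linear algebra. A functional that vanishes on the kernel of B(v, .) is
    a multiple of it, so H^bot = R v + K, where K is the kernel of B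
    ([biorthogonal_line]). On this space B is t v + w |-> t^2 B(v, v), so its index is
    1 if a > 0 and 0 otherwise. Moreover H contains K, and H meets H^bot in K if
    a <> 0 and in R v + K if a = 0. The dimensions therefore contribute 1 exactly when
    a = 0 and v is not in K, that is when a = 0 and d G(p_s) <> 0
    ([index_biorthogonal]). All claims can be read off.

    Two analytic facts are behind this. First, the dimensions must be finite for their
    difference to make sense, so K must be finite dimensional. By convexity in v,
    B((xi, 0), (xi, 0)) is at least a positive multiple of |xi'|^2 up to an error
    bounded by C d |xi|^2 whenever the sup norm of xi is at most d |xi|
    ([action_coercive]). If xi vanishes at the points i / (m + 1), then Hoelder
    continuity gives such a bound with d = (m + 1)^(-1/2). So for m large an element of
    K is determined by b and by its values at these points ([ker_diff2_has_dim]).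

    Second, the action must be differentiable on W^{1,2} x (0, oo), its differential in
    a fixed direction must be differentiable again, and B must be symmetric. Since L is
    quadratic in the velocity, the action is a combination, with powers of T as
    coefficients, of functionals x |-> int f(x) g P(x) Q(x), where f is C^2 and P and Q
    are affine maps to L^2 ([action_funE]). These are differentiable by a Taylor
    expansion of f that is uniform along x ([is_diff_block]), and their differentials in
    a fixed direction are sums of functionals of the same form ([twice_diff_block]).
    Symmetry is Young's theorem ([diff2_sym]). *)

(** * Dimension and negative index on a line plus the radical *)

Section Dimension.
Context {R : realType} {V : lmodType R}.
Implicit Types (W U : set V).

(** Finite dimension in terms of independent families: unlike the extended real
    [lin_dim W], it provides a maximal family to work with. *)
Definition has_dim W (d : nat) :=
  (exists2 u : 'I_d -> V, (forall i, W (u i)) & lin_indep u) /\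
  forall u : 'I_d.+1 -> V, (forall i, W (u i)) -> ~ lin_indep u.

Lemma lin_indep_sub k m (le_km : (k <= m)%N) (u : 'I_m -> V) :
  lin_indep u -> lin_indep (u \o widen_ord le_km).
Proof.
move=> iu a a0 i.
pose b (j : 'I_m) := if insub (val j) is Some j' then a j' else 0 : R.
have bE j : b (widen_ord le_km j) = a j by rewrite /b /= valK.
rewrite -bE; apply: iu; rewrite -[RHS]a0.
rewrite (bigID (fun j : 'I_m => (j < k)%N)) /= [X in _ + X]big1 ?addr0; last first.
  by move=> j jk; rewrite /b insubN// scale0r.
rewrite (big_ord_narrow le_km); apply: eq_bigr => j _; congr (_ *: _).
exact: bE.
Qed.

Lemma lin_dim_le W d : (forall u : 'I_d.+1 -> V, (forall i, W (u i)) ->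
  ~ lin_indep u) -> (lin_dim W <= (d%:R)%:E)%E.
Proof.
move=> noW; apply: ge_ereal_sup => _ [m [u Wu iu] <-].
rewrite lee_fin ler_nat leqNgt; apply/negP => dm.
refine (noW (u \o widen_ord dm) _ _); last exact: lin_indep_sub.
by move=> i; exact: Wu.
Qed.

Lemma lin_dim_ge W d (u : 'I_d -> V) : (forall i, W (u i)) -> lin_indep u ->
  ((d%:R)%:E <= lin_dim W)%E.
Proof.
by move=> Wu iu; apply: ereal_sup_ubound; exists d => //; exists u.
Qed.

Lemma has_dim_lin_dim W d : has_dim W d -> lin_dim W = (d%:R)%:E.
Proof.
move=> [[u Wu iu] noW]; apply/eqP; rewrite eq_le lin_dim_le//=.
exact: lin_dim_ge Wu iu.
Qed.

Lemma subspace_sum W k (a : 'I_k -> R) (u : 'I_k -> V) : is_subspace W ->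
  (forall i, W (u i)) -> W (\sum_i a i *: u i).
Proof.
move=> [W0 Wlin] Wu; apply: (big_ind W) => //.
- by move=> x y Wx Wy; rewrite -[x]scale1r; exact: Wlin.
- by move=> i _; rewrite -[_ *: _]addr0; exact: Wlin.
Qed.

(** A linear map to R^N with no kernel on W turns independent families into matrices
    with independent rows, so such families have at most N members. *)
Lemma has_dim_embedding W N (e : V -> 'rV[R]_N) : is_subspace W ->
  (forall a u v, e (a *: u + v) = a *: e u + e v) ->
  (forall u, W u -> e u = 0 -> u = 0) -> exists d, has_dim W d.
Proof.
move=> sW elin einj.
have e0 : e 0 = 0.
  by have := elin (-1) 0 0; rewrite scaleN1r addNr scaleN1r addNr.
have esum k (a : 'I_k -> R) u : e (\sum_i a i *: u i) = \sum_i a i *: e (u i).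
  elim/big_rec2 : _ => // i y x _ <-; exact: elin.
have bnd k (u : 'I_k -> V) : (forall i, W (u i)) -> lin_indep u -> (k <= N)%N.
  move=> Wu iu; pose M := \matrix_i e (u i).
  suff rM : \rank M = k by rewrite -rM; exact: rank_leq_col.
  apply/eqP; rewrite -/(row_free M) -kermx_eq0; apply/eqP/row_matrixP => i.
  rewrite row0; apply/rowP => j; rewrite [RHS]mxE.
  apply: (iu (fun j => row i (kermx M) 0 j)).
  apply: einj; first exact: subspace_sum.
  rewrite esum; transitivity (row i (kermx M) *m M).
    by rewrite mulmx_sum_row; apply: eq_bigr => l _; rewrite rowK.
  by rewrite -row_mul mulmx_ker row0.
pose P k := `[< exists2 u : 'I_k -> V, (forall i, W (u i)) & lin_indep u >].
have exP : exists k, P k.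
  by exists 0%N; apply/asboolP; exists (fun=> 0) => [|a _]; case.
have bP k : P k -> (k <= N)%N by move=> /asboolP[u Wu iu]; exact: bnd Wu iu.
have [d /asboolP Pd dmax] := ex_maxnP exP bP.
exists d; split=> // u Wu iu.
suff : (d.+1 <= d)%N by rewrite ltnn.
by apply: dmax; apply/asboolP; exists u.
Qed.

Definition add_line (v : V) W : set V :=
  [set u | exists a w, W w /\ u = a *: v + w].

(** An independent family of d + 2 vectors in R v + W would, after elimination of v,
    leave d + 1 independent vectors in W. *)
Lemma has_dim_add_line W v d : is_subspace W -> ~ W v -> has_dim W d ->
  has_dim (add_line v W) d.+1.
Proof.
move=> sW Wv [[u Wu iu] noW]; have [W0 Wlin] := sW; split.
  exists (fun i => if unlift ord0 i is Some j then u j else v).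
    move=> i; case: unliftP => [j|] _; first by exists 0, (u j); rewrite scale0r add0r.
    by exists 1, 0; rewrite scale1r addr0.
  move=> a; rewrite big_ord_recl unlift_none.
  under eq_bigr do rewrite liftK.
  move=> a0; have av : a ord0 = 0.
    apply/eqP/negPn/negP => a00; apply: Wv.
    have -> : v = - (a ord0)^-1 *: \sum_(i < d) a (lift ord0 i) *: u i + 0.
      have -> : \sum_(i < d) a (lift ord0 i) *: u i = - (a ord0 *: v).
        by apply/eqP; rewrite -addr_eq0 addrC a0.
      by rewrite scalerN scaleNr opprK scalerA mulVf// scale1r addr0.
    by apply: (Wlin) => //; exact: subspace_sum.
  move=> i; case: (unliftP ord0 i) => [j|] -> //.
  by apply: (iu (a \o lift ord0)); rewrite -[RHS]a0 av scale0r add0r.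
move=> z Lz iz.
have Lz' i : {a : R & {w | W w & z i = a *: v + w}}.
  by have /cid[a /cid[w [Ww zE]]] := Lz i; exists a, w.
pose a i := projT1 (Lz' i); pose w i := s2val (projT2 (Lz' i)).
have Ww i : W (w i) by rewrite /w; case: (projT2 (Lz' i)).
have zE i : z i = a i *: v + w i by rewrite /w /a; case: (projT2 (Lz' i)).
have [a0|] := pselect (forall i, a i = 0).
  refine (noW (z \o widen_ord (leqnSn d.+1)) _ _); last exact: lin_indep_sub.
  move=> i /=.
  by rewrite zE a0 scale0r add0r.
move=> /existsNP[i0 /eqP ai0].
(* Eliminate v with the pivot z i0, whose coefficient on v is nonzero. *)
pose r j := a (lift i0 j) / a i0.
pose y (j : 'I_d.+1) := z (lift i0 j) - r j *: z i0.
refine (noW y _ _) => [j|b b0 j].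
  have -> : y j = - r j *: w i0 + w (lift i0 j).
    rewrite /y !zE scalerDr scalerA /r divfK// opprD addrACA subrr add0r.
    by rewrite scaleNr addrC.
  exact: Wlin.
pose b' i := if unlift i0 i is Some j then b j else - \sum_j b j * r j.
have <- : b' (lift i0 j) = b j by rewrite /b' liftK.
apply: iz; rewrite (bigD1_ord i0)//= {1}/b' unlift_none -[RHS]b0.
rewrite scaleNr scaler_suml addrC -sumrB; apply: eq_bigr => k _.
by rewrite /b' liftK /y scalerBr scalerA.
Qed.

End Dimension.

Section Index.
Context {R : realType} {V : lmodType R}.
Variables (X : set V) (B : V -> V -> R) (v : V).
Hypotheses (sX : is_subspace X) (Xv : X v).
Hypothesis Blin : forall a h h' k, B (a *: h + h') k = a * B h k + B h' k.
Hypothesis Bsym : forall h k, B h k = B k h.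

Let N := [set h | X h /\ B h v = 0].
Let P := [set h | X h /\ forall k, N k -> B h k = 0].
Let K := [set h | X h /\ forall k, X k -> B h k = 0].

Let BlinR a h h' k : B k (a *: h + h') = a * B k h + B k h'.
Proof. by rewrite Bsym Blin !(Bsym k). Qed.

Let B0 k : B 0 k = 0.
Proof. by have := Blin (-1) 0 0 k; rewrite scaleN1r addNr; lra. Qed.

Lemma radical_subspace : is_subspace K.
Proof.
have [X0 Xlin] := sX; split; first by split.
move=> a u w [Xu Ku] [Xw Kw]; split; first exact: Xlin.
by move=> k Xk; rewrite Blin Ku// Kw// mulr0 addr0.
Qed.

(** If B(h, .) vanishes on the kernel of B(v, .), it is a multiple t B(v, .) of it,
    and then h - t v is in the radical K. *)
Lemma biorthogonal_line : P = add_line v K.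
Proof.
have [X0 Xlin] := sX.
apply/seteqP; split=> [h [Xh Ph]|_ [a [w [[Xw Kw] ->]]]]; last first.
  split; first exact: Xlin.
  by move=> k [Xk Nk]; rewrite Blin Kw// Bsym Nk mulr0 addr0.
have [Kv|] := pselect (forall k, X k -> B k v = 0).
  exists 0, h; split; last by rewrite scale0r add0r.
  by split=> // k Xk; apply: Ph; split=> //; exact: Kv.
move=> /existsNP[k0 /not_implyP[Xk0 /eqP Bk0]].
pose t := B h k0 / B k0 v.
exists t, (- t *: v + h); split; last by rewrite scaleNr addNKr.
split; first exact: Xlin.
move=> k Xk; pose s := - (B k v / B k0 v).
have : B h (s *: k0 + k) = 0.
  apply: Ph; split; first exact: Xlin.
  by rewrite Blin /s mulNr divfK// addNr.
by rewrite BlinR Blin /s (Bsym v) /t => e; rewrite -[RHS]e; field.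
Qed.

Let line_form a w : K w -> B (a *: v + w) (a *: v + w) = a ^+ 2 * B v v.
Proof.
move=> [Xw Kw]; rewrite Blin !BlinR Kw// (Kw w)// (Bsym v w) Kw//; ring.
Qed.

(** On R v + K the form is a v + w |-> a^2 B(v, v). Two independent vectors have a
    nonzero combination in K, where the form vanishes, so a negative definite
    subspace is at most a line. *)
Lemma neg_index_line :
  neg_index (fun h => B h h) (add_line v K) = if B v v < 0 then 1%E else 0%E.
Proof.
have [K0 Klin] := radical_subspace.
have bounded U : is_subspace U -> U `<=` add_line v K ->
    (forall u, U u -> u <> 0 -> B u u < 0) ->
    (lin_dim U <= if (B v v < 0)%R then 1 else 0)%E.
  move=> sU UL Uneg; have [Bv|Bv] := ltP (B v v) 0; last first.
    apply: (@lin_dim_le _ _ U 0) => u Uu iu.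
    have [u0|u0] := pselect (u ord0 = 0).
      have e1 : \sum_(i < 1) (1 : R) *: u i = 0 by rewrite big_ord1 u0 scaler0.
      by have /eqP := iu (fun=> 1) e1 ord0; rewrite oner_eq0.
    have [a [w [Kw uE]]] := UL _ (Uu ord0).
    by have := Uneg _ (Uu ord0) u0; rewrite uE line_form//; have := sqr_ge0 a; nra.
  apply: (@lin_dim_le _ _ U 1) => u Uu iu.
  have [a [w [Kw aE]]] := UL _ (Uu ord0).
  have [b [w' [Kw' bE]]] := UL _ (Uu ord_max).
  have comb s t : s *: u ord0 + t *: u ord_max = 0 -> s = 0 /\ t = 0.
    move=> st.
    have stE : \sum_(i < 2) (if i == ord0 then s else t) *: u i = 0.
      by rewrite big_ord_recl big_ord1/= -[RHS]st; congr (_ + _ *: u _);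
        exact/val_inj.
    pose f (i : 'I_2) := if i == ord0 then s else t.
    by split; [exact: (iu f stE ord0)|exact: (iu f stE ord_max)].
  (* The combination in which v cancels. *)
  pose z := b *: u ord0 + (- a *: u ord_max + 0).
  have Uz : U z by apply: (sU.2) => //; apply: (sU.2) => //; exact: sU.1.
  have zE : z = b *: w + (- a *: w' + 0).
    rewrite /z aE bE !scalerDr !addr0 !scalerA addrACA -scalerDl.
    by rewrite mulNr [a * b]mulrC subrr scale0r add0r.
  have Kz : K z by rewrite zE; apply: (Klin) => //; exact: Klin.
  have [z0|z0] := pselect (z = 0); last first.
    by have := Uneg _ Uz z0; rewrite Kz.2 ?ltxx//; exact: Kz.1.
  have [b0 a0] : b = 0 /\ - a = 0 by apply: comb; rewrite -[RHS]z0 /z addr0.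
  have u0 : u ord0 <> 0.
    move=> u0; suff [/eqP] : (1 : R) = 0 /\ (0 : R) = 0 by rewrite oner_eq0.
    by apply: comb; rewrite u0 scaler0 scale0r addr0.
  have Ku : K (u ord0).
    by rewrite aE (_ : a = 0) ?scale0r ?add0r//; apply/eqP; rewrite -oppr_eq0 a0.
  by have := Uneg _ (Uu ord0) u0; rewrite Ku.2 ?ltxx//; exact: Ku.1.
apply/eqP; rewrite eq_le; apply/andP; split.
  by apply: ge_ereal_sup => _ [U [sU UL Uneg] <-]; exact: bounded.
have [Bv|Bv] := ltP (B v v) 0; last first.
  apply: ereal_sup_ge; exists (lin_dim [set (0:V)]).
    exists [set 0] => //; split => //.
    - by split=> // a u w -> ->; rewrite scaler0 addr0.
    - by move=> _ ->; exists 0, 0; rewrite scale0r addr0.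
  by apply: (@lin_dim_ge _ _ _ 0 (fun=> 0)) => // a _ [].
apply: ereal_sup_ge; exists (lin_dim [set u | exists a, u = a *: v]).
  exists [set u | exists a, u = a *: v] => //; split.
  - split; first by exists 0; rewrite scale0r.
    by move=> a _ _ [s ->] [t ->]; exists (a * s + t); rewrite scalerDl scalerA.
  - by move=> _ [a ->]; exists a, 0; rewrite addr0.
  - move=> _ [a ->] av; have := line_form a K0; rewrite addr0 => ->.
    rewrite pmulr_rlt0// exprn_even_gt0//=; apply/eqP => a0; apply: av.
    by rewrite a0 scale0r.
apply: (@lin_dim_ge _ _ _ 1 (fun=> v)) => [_|a]; first by exists 1; rewrite scale1r.
rewrite big_ord1 => av i; rewrite ord1; apply/eqP/negPn/negP => a0.
have v0 : v = 0 by rewrite -[v]scale1r -(mulVf a0) -scalerA av scaler0.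
by move: Bv; rewrite v0 B0 ltxx.
Qed.

(** The algebraic core. P is R v + K, on which the index is known; N meets it in K
    when B(v, v) <> 0 and in all of R v + K when B(v, v) = 0, so the difference of
    dimensions is 1 exactly when B(v, v) = 0 and v is not in the radical. Finite
    dimension of K is what makes the difference meaningful. *)
Lemma index_biorthogonal d : has_dim K d ->
  (neg_index (fun h => B h h) P + lin_dim (N `&` P) - lin_dim (N `&` K))%E =
  if (B v v < 0) || (B v v == 0) && `[< ~ K v >] then 1%E else 0%E.
Proof.
move=> Kd; have [K0 Klin] := radical_subspace.
have NK : N `&` K = K.
  by apply/seteqP; split=> [h []//|h Kh]; split=> //; split; case: Kh => // Xh ->.
have NP0 : B v v != 0 -> N `&` P = K.
  move=> Bv; apply/seteqP; split=> [h [[Xh hv]]|h Kh].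
    rewrite biorthogonal_line => -[a [w [Kw hE]]]; move: hv.
    rewrite hE Blin (Kw.2 v)// addr0 => /eqP; rewrite mulf_eq0 (negPf Bv) orbF.
    by move=> /eqP ->; rewrite scale0r add0r.
  rewrite -NK in Kh; case: Kh => Nh Kh; split=> //.
  by rewrite biorthogonal_line; exists 0, h; rewrite scale0r add0r.
have NP1 : B v v = 0 -> N `&` P = add_line v K.
  rewrite biorthogonal_line => Bv; apply/seteqP; split=> [h []//|h Lh].
  split=> //; case: Lh => a [w [[Xw Kw] ->]]; split; first exact: sX.2.
  by rewrite Blin Kw// Bv; ring.
rewrite NK {1}biorthogonal_line neg_index_line (has_dim_lin_dim Kd).
have [Bv|Bv|Bv] := ltgtP (B v v) 0 => /=.
- by rewrite NP0 ?lt_eqF// (has_dim_lin_dim Kd) addeK.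
- by rewrite NP0 ?gt_eqF// (has_dim_lin_dim Kd) add0e subee.
- rewrite NP1// add0e; have [Kv|Kv] := asboolP (~ K v).
    rewrite (has_dim_lin_dim (has_dim_add_line radical_subspace Kv Kd)).
    by rewrite -EFinB -[d.+1]addn1 natrD addrAC subrr add0r.
  rewrite (_ : add_line v K = K) ?(has_dim_lin_dim Kd) ?subee//.
  apply/seteqP; split=> [_ [a [w [Kw ->]]]|h Kh].
    by apply: Klin => //; exact: contrapT.
  by exists 0, h; rewrite scale0r add0r.
Qed.

End Index.

(** * Second differentials on a normed space *)

Section Frechet.
Context {R : realType} {V : normedModType R}.
Implicit Types (f F : V -> R) (p h k : V).

Lemma is_diff_from_bound f p (df : V -> R) (K : R) :
  (forall a h k, df (a *: h + k) = a * df h + df k) ->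
  (forall h, `|df h| <= K * `|h|) ->
  (forall e, 0 < e -> exists2 d, 0 < d & forall h, `|h| <= d ->
    `|f (p + h) - f p - df h| <= e * `|h|) ->
  is_diff p f df.
Proof.
move=> dlin dbnd dapp.
pose L : {linear V -> R} := HB.pack df (GRing.isLinear.Build R V R *:%R df dlin).
have cL : continuous L.
  apply/linear_bounded_continuous/linear_boundedP.
  exists (`|K|); split; first by rewrite realE normr_ge0.
  move=> M KM y; apply: (le_trans (dbnd y)).
  by rewrite ler_wpM2r// (le_trans (ler_norm K))// ltW.
have app : f \o shift p = cst (f p) + L +o_ 0 id.
  apply/eqaddoP => e e0; have [d d0 dle] := dapp _ e0.
  near=> h.
  rewrite -[X in `|X|]/(f (h + p) - (f p + df h)) opprD addrA [h + p]addrC.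
  by apply: dle; near: h; exact: nbhs0_le.
have dE : 'd f p = L :> (V -> R) by exact: diff_unique.
split=> //; apply/diff_locallyP; split; rewrite dE//.
Unshelve. all: by end_near. Qed.

Lemma diff_expansion f p : differentiable f p ->
  forall e, 0 < e -> exists2 d, 0 < d & forall h, `|h| <= d ->
    `|f (p + h) - f p - 'd f p h| <= e * `|h|.
Proof.
move=> /diff_locallyP[_ /eqaddoP app] e e0.
have := app _ e0 => /nbhs_normP[d /= d0 dle].
exists (d / 2); first by rewrite divr_gt0.
move=> h hd; have : `|0 - h| < d.
  by rewrite sub0r normrN (le_lt_trans hd)// ltr_pdivrMr// ltr_pMr// ltr1n.
move=> /dle /=; rewrite -[X in `|X|]/(f (h + p) - (f p + 'd f p h)) /=.
by rewrite opprD addrA [h + p]addrC.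
Qed.

Lemma is_derive_line f p h (r : R) : differentiable f (p + r *: h) ->
  is_derive r 1 (fun s : R => f (p + s *: h)) ('d f (p + r *: h) h).
Proof.
move=> df.
have dl : is_diff r (fun s : R => p + s *: h) ( *:%R^~ h).
  rewrite -[X in is_diff r X _]/(cst p + ( *:%R^~ h)) -[X in is_diff r _ X]add0r.
  exact: is_diffD.
have dc : is_diff r (f \o (fun s => p + s *: h)) ('d f (p + r *: h) \o ( *:%R^~ h)).
  by apply: is_diff_comp; exact: differentiableP.
have := @ex_diff _ _ _ _ _ _ _ dc => dfl.
apply: DeriveDef; first exact/derivable1_diffP.
by rewrite deriveE// (@diff_val _ _ _ _ _ _ _ dc) /= scale1r.
Qed.

(** Chain rule along a path, one-sided at the ends of the interval. *)
Lemma diff_lim_quot (D : set R) (q : R -> V) f (s : R) (v : V) :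
  diff_quot_in D q s --> v -> differentiable f (q s) ->
  diff_quot_in D (f \o q) s --> 'd f (q s) v.
Proof.
rewrite /diff_quot_in => qv df.
set A := within D s^'.
have FA : Filter A by exact: within_filter.
pose Q t := (t - s)^-1 *: (q t - q s).
have dfv : ('d f (q s) (Q t) @[t --> A]) --> 'd f (q s) v.
  by apply: continuous_cvg => //; exact: diff_continuous.
have v1 : 0 < `|v| + 1 by rewrite ltr_wpDl.
apply/cvgrPdist_le => e e0.
have e'0 : 0 < e / 2 / (`|v| + 1) by rewrite !divr_gt0.
have [d d0 dle] := diff_expansion df e'0.
have Aneq : \forall t \near A, t != s.
  by apply: (@cvg_within _ s^' _ D); exact: (@nbhs_dnbhs_neq R s).
have Asmall : \forall t \near A, `|t - s| <= d / (`|v| + 1).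
  apply: (@cvg_within _ s^' _ D); apply: nbhs_dnbhs.
  apply/nbhs_normP; exists (d / (`|v| + 1)) => /=; first by rewrite divr_gt0.
  by move=> t /=; rewrite distrC; exact: ltW.
near=> t.
have ts : t - s != 0 by rewrite subr_eq0; near: t.
have Qle : `|Q t| <= `|v| + 1.
  near: t; apply: (cvgr_norm_le v qv).
  by rewrite ltrDl.
have qE : q t - q s = (t - s) *: Q t by rewrite scalerA divff// scale1r.
have qle : `|q t - q s| <= d.
  rewrite qE normrZ (@le_trans _ _ (d / (`|v| + 1) * (`|v| + 1)))//; last first.
    by rewrite divfK// gt_eqF.
  by apply: ler_pM => //; near: t.
have := dle _ qle; rewrite [q s + _]addrC subrK => fle.
have -> : 'd f (q s) v - (t - s)^-1 *: (f (q t) - f (q s)) =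
    ('d f (q s) v - 'd f (q s) (Q t)) -
    (t - s)^-1 * (f (q t) - f (q s) - 'd f (q s) (q t - q s)).
  have -> : 'd f (q s) (q t - q s) = (t - s) * 'd f (q s) (Q t).
    by rewrite qE linearZ.
  by rewrite -[_ *: _]/(_ * _); field.
rewrite (le_trans (ler_normB _ _))// [e]splitr lerD//.
  by near: t; move/cvgrPdist_le : dfv; apply; rewrite divr_gt0.
rewrite normrM normfV ler_pdivrMl ?normr_gt0//; apply: (le_trans fle).
rewrite qE normrZ mulrCA ler_wpM2l//.
by rewrite (le_trans (ler_wpM2l (ltW e'0) Qle))// divfK// gt_eqF.
Unshelve. all: by end_near. Qed.

(** The regularity at a point under which [diff2] is a symmetric bilinear form. The
    differential must exist near p for q |-> 'd F q h to be meaningful. *)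
Definition twice_diff F p :=
  (\forall q \near p, differentiable F q) /\
  forall h, differentiable (fun q => 'd F q h) p.

Lemma twice_diff_differentiable F p : twice_diff F p -> differentiable F p.
Proof. by case=> /nbhs_singleton. Qed.

(** The mean value theorem in direction h turns the second difference into
    s (G(p + c h + s k) - G(p + c h)) with G = 'd F . h, and G is differentiable
    at p. *)
Lemma second_difference F p h k : twice_diff F p -> forall e, 0 < e ->
  \forall s \near 0^'+, `|F (p + s *: k + s *: h) - F (p + s *: h) -
    (F (p + s *: k) - F p) - s ^+ 2 * diff2 F p h k| <= e * s ^+ 2.
Proof.
move=> [/nbhs_normP[r /= r0 Fr] dG] e e0.
(* M bounds the length of the increments c h + s k, 0 <= c <= s, relative to s. *)
pose M := `|h| + `|k| + 1.
have M0 : 0 < M by rewrite ltr_wpDl// addr_ge0.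
have e'0 : 0 < e / (2 * M) by rewrite divr_gt0// mulr_gt0.
have [d d0 dle] := diff_expansion (dG h) e'0.
near=> s.
have s0 : 0 < s by [].
have sd : s * M <= d.
  rewrite -ler_pdivlMr//; near: s; apply: nbhs_right_le; exact: divr_gt0.
have sr : s * M < r.
  by rewrite -ltr_pdivlMr//; near: s; apply: nbhs_right_lt; exact: divr_gt0.
have small c y : 0 <= c <= s -> (y = 0 \/ y = s *: k) -> `|y + c *: h| <= s * M.
  move=> /andP[c0 cs] yE; rewrite (le_trans (ler_normD _ _))//.
  rewrite normrZ ger0_norm// /M !mulrDr mulr1 addrAC.
  have : `|y| <= s * `|k|.
    by case: yE => ->; [rewrite normr0 mulr_ge0// ltW|rewrite normrZ gtr0_norm].
  have := ler_wpM2r (normr_ge0 h) cs; lra.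
have Fd c y : 0 <= c <= s -> (y = 0 \/ y = s *: k) ->
    differentiable F (p + y + c *: h).
  move=> cs yE; apply: Fr => /=; rewrite -addrA opprD addrA.
  by rewrite subrr sub0r normrN (le_lt_trans (small _ _ cs yE)).
pose psi c := F (p + s *: k + c *: h) - F (p + 0 + c *: h).
pose dpsi c := 'd F (p + s *: k + c *: h) h - 'd F (p + 0 + c *: h) h.
have psid c : 0 <= c <= s -> is_derive c 1 psi (dpsi c).
  move=> cs; apply: is_deriveB; apply: is_derive_line; apply: Fd => //;
    by [left|right].
have [c||c] := @MVT_segment R psi dpsi 0 s (ltW s0).
- by rewrite in_itv /= => /andP[c0 cs]; apply: psid; rewrite !ltW.
- apply: derivable_within_continuous => c.
  by rewrite in_itv /= => cs; have [] := psid _ cs.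
rewrite in_itv /= => cs; rewrite /psi !scale0r !addr0 subr0 => ->.
have h1 := dle _ (le_trans (small _ _ cs (or_intror erefl)) sd).
have h2 := dle _ (le_trans (small _ _ cs (or_introl erefl)) sd).
have b1 := ler_wpM2l (ltW e'0) (small _ _ cs (or_intror erefl)).
have b2 := ler_wpM2l (ltW e'0) (small _ _ cs (or_introl erefl)).
have eE : e / (2 * M) * (s * M) = e * s / 2 by field; rewrite gt_eqF.
have := le_trans h1 b1; have := le_trans h2 b2; rewrite eE.
set G := fun q => 'd F q h; rewrite -/(G p) -/(G _) !addrA.
rewrite !(linearD ('d G p)) linear0 add0r [in 'd _ _ (s *: k)]linearZ/=.
rewrite /dpsi -!/(G _) -/(diff2 F p h k) => {}h2 {}h1.
have e1 : `|G (p + s *: k + c *: h) - G (p + 0 + c *: h) - s * diff2 F p h k|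
    <= e * s.
  move: h1 h2; rewrite -[s *: diff2 _ _ _ _]/(s * _) !ler_norml.
  by move=> /andP[? ?] /andP[? ?]; apply/andP; split; lra.
rewrite -/(G _) -/(G _) -[X in `|X|](_ : s * (G (p + s *: k + c *: h) -
    G (p + 0 + c *: h) - s * diff2 F p h k) = _); last by ring.
by rewrite normrM gtr0_norm// expr2 mulrA [_ * s]mulrC ler_wpM2l// ltW.
Unshelve. all: by end_near. Qed.

(** Young's theorem: both mixed second derivatives are the limit of the same
    second difference quotient. *)
Lemma diff2_sym F p h k : twice_diff F p -> diff2 F p h k = diff2 F p k h.
Proof.
move=> FF; apply/eqP; rewrite -subr_eq0 -normr_le0; apply/ler_addgt0Pr => e e0.
have e20 : 0 < e / 2 by rewrite divr_gt0.
near (0 : R)^'+ => s.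
have s0 : 0 < s by [].
have h1 : `|F (p + s *: k + s *: h) - F (p + s *: h) -
    (F (p + s *: k) - F p) - s ^+ 2 * diff2 F p h k| <= e / 2 * s ^+ 2.
  by near: s; exact: second_difference.
have h2 : `|F (p + s *: h + s *: k) - F (p + s *: k) -
    (F (p + s *: h) - F p) - s ^+ 2 * diff2 F p k h| <= e / 2 * s ^+ 2.
  by near: s; exact: second_difference.
have s20 : 0 < s ^+ 2 by rewrite exprn_gt0.
rewrite add0r -(ler_pM2r s20) -{1}(gtr0_norm s20) -normrM.
move: h1 h2; rewrite (addrAC p) !ler_norml => /andP[? ?] /andP[? ?].
by apply/andP; split; lra.
Unshelve. all: by end_near. Qed.

Lemma diff2_linl F p : twice_diff F p -> forall a h h' k,
  diff2 F p (a *: h + h') k = a * diff2 F p h k + diff2 F p h' k.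
Proof.
move=> [_ dF] a h h' k; rewrite /diff2.
rewrite (_ : (fun q => 'd F q (a *: h + h')) =
    a *: (fun q => 'd F q h) + (fun q => 'd F q h')); last first.
  by apply/funext => q; rewrite linearP.
apply: etrans (congr1 (@^~ k) (diffD (differentiableZ a (dF h)) (dF h'))) _.
by congr (_ + _); exact: (congr1 (@^~ k) (diffZ a (dF h))).
Qed.

Lemma is_diff_near_eq f g p (dg : V -> R) : {near p, f =1 g} ->
  is_diff p g dg -> is_diff p f dg.
Proof.
move=> /nbhs_normP[r /= r0 fg] [dfg <-].
have [K K0 Kle] := linear_lipschitz (diff_continuous dfg).
apply: (is_diff_from_bound (K := K)) => // [a h k|e e0]; first by rewrite linearP.
have [d d0 dle] := diff_expansion dfg e0.
exists (Num.min d (r / 2)); first by rewrite lt_min d0 divr_gt0.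
move=> h; rewrite le_min => /andP[hd hr].
have pr y : `|y| <= r / 2 -> ball_ Num.norm p r (p + y).
  move=> yr; rewrite /= opprD addrA subrr sub0r normrN (le_lt_trans yr)//.
  by rewrite ltr_pdivrMr// ltr_pMr// ltr1n.
have fp : f p = g p by rewrite -[p]addr0; apply/fg/pr; rewrite normr0 divr_ge0// ltW.
have fph : f (p + h) = g (p + h) by apply/fg/pr.
by rewrite fp fph; apply: dle.
Qed.

(** A formula for the differential that is valid near p may be differentiated in its
    place. *)
Lemma twice_diff_intro F (dF : V -> V -> R) p :
  (\forall q \near p, is_diff q F (dF q)) ->
  (forall h, differentiable (fun q => dF q h) p) ->
  twice_diff F p /\ forall h k, diff2 F p h k = 'd (fun q => dF q h) p k.
Proof.
move=> FdF ddF.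
have ddE h : is_diff p (fun q => 'd F q h) ('d (fun q => dF q h) p).
  apply: is_diff_near_eq (differentiableP (ddF h)).
  by apply: filterS FdF => q dq; rewrite diff_val.
split=> [|h k]; last by rewrite /diff2 diff_val.
by split=> // ; apply: filterS FdF => q dq.
Qed.

Lemma twice_diffD F G p : twice_diff F p -> twice_diff G p ->
  twice_diff (F + G) p /\
  forall h k, diff2 (F + G) p h k = diff2 F p h k + diff2 G p h k.
Proof.
move=> [F1 F2] [G1 G2].
have [|h|FG E] := @twice_diff_intro (F + G) (fun q h => 'd F q h + 'd G q h) p.
- apply: filterS2 F1 G1 => q Fq Gq.
  by apply: is_diffD; exact: differentiableP.
- by apply: (differentiableD (F2 h) (G2 h)).
split=> // h k; rewrite E /diff2.
exact: (congr1 (@^~ k) (diffD (F2 h) (G2 h))).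
Qed.

Lemma twice_diffZ (a : R) F p : twice_diff F p ->
  twice_diff (a *: F) p /\ forall h k, diff2 (a *: F) p h k = a * diff2 F p h k.
Proof.
move=> [F1 F2].
have [|h|FG E] := @twice_diff_intro (a *: F) (fun q h => a *: 'd F q h) p.
- by apply: filterS F1 => q Fq; apply: is_diffZ; exact: differentiableP.
- by apply: (differentiableZ a (F2 h)).
split=> // h k; rewrite E /diff2.
exact: (congr1 (@^~ k) (diffZ a (F2 h))).
Qed.

Lemma twice_diff_cst (a : R) p :
  twice_diff (cst a) p /\ forall h k, diff2 (cst a : V -> R) p h k = 0.
Proof.
have [|h|FG E] := @twice_diff_intro (cst a) (fun=> 0) p.
- by near=> q; exact: is_diff_cst.
- exact: differentiable_cst.
by split=> // h k; rewrite E diff_cst.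
Unshelve. all: by end_near. Qed.

Lemma twice_diff_sum (I : Type) (r : seq I) (F : I -> V -> R) p :
  (forall i, twice_diff (F i) p) -> twice_diff (\sum_(i <- r) F i) p /\
  forall h k, diff2 (\sum_(i <- r) F i) p h k = \sum_(i <- r) diff2 (F i) p h k.
Proof.
move=> Ft; elim: r => [|i r [IH E]].
  rewrite big_nil; have [c0 E] := twice_diff_cst 0 p.
  by split=> // h k; rewrite big_nil E.
rewrite big_cons; have [FG E'] := twice_diffD (Ft i) IH.
by split=> // h k; rewrite E' E big_cons.
Qed.

Lemma twice_diffM F G p : twice_diff F p -> twice_diff G p ->
  twice_diff (F * G) p.
Proof.
move=> FF GG; have [F1 F2] := FF; have [G1 G2] := GG.
have [|h|//] := @twice_diff_intro (F * G)
  (fun q h => F q *: 'd G q h + G q *: 'd F q h) p.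
- by apply: filterS2 F1 G1 => q Fq Gq; apply: is_diffM; exact: differentiableP.
- have dF := twice_diff_differentiable FF; have dG := twice_diff_differentiable GG.
  exact: (differentiableD (differentiableM dF (G2 h)) (differentiableM dG (F2 h))).
Qed.

End Frechet.

Lemma twice_diff_affine (R : realType) (U V : normedModType R) (F : V -> R)
  (g i : U -> V) (p : U) : (forall q, is_diff q g i) -> twice_diff F (g p) ->
  twice_diff (F \o g) p /\
  forall h k, diff2 (F \o g) p h k = diff2 F (g p) (i h) (i k).
Proof.
move=> gi [F1 F2].
have dg q : differentiable g q by have [] := gi q.
have [|h|Fg E] := @twice_diff_intro _ _ (F \o g) (fun q h => 'd F (g q) (i h)) p.
- have Fg : \forall q \near p, differentiable F (g q).
    exact: (differentiable_continuous (dg p) F1).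
  apply: filterS Fg => q Fq.
  by apply: is_diff_comp; exact: differentiableP.
- by apply: (differentiable_comp (dg p) (F2 (i h))).
split=> // h k; rewrite E.
apply: etrans (congr1 (@^~ k) (diff_comp (dg p) (F2 (i h)))) _.
by rewrite /= (@diff_val _ _ _ _ _ _ _ (gi p)).
Qed.

Lemma twice_diff_inv (R : realType) (t : R) : t != 0 -> twice_diff (@GRing.inv R) t.
Proof.
move=> t0; have [|h|//] := @twice_diff_intro R R (@GRing.inv R) (fun q h => - q ^- 2 *: h) t.
  have /filterS : \forall q \near t, q != 0.
    by near=> q; near: q; apply/open_nbhs_nbhs; split=> //; exact: open_neq.
  by apply=> q q0; apply: DiffDef; [exact: differentiable_Rinv|rewrite diff_Rinv].
rewrite (_ : (fun q => _) = cst (- h) * (fun q => (q ^+ 2)^-1)).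
  apply: differentiableM => //; apply: differentiableV => /=.
    exact: (@differentiableM _ _ (id : R -> R) (id : R -> R)).
  by rewrite expf_neq0.
apply/funext => q; rewrite -[LHS]/(- q ^- 2 * h) -[RHS]/(- h * (q ^+ 2)^-1).
by rewrite !mulNr mulrC.
Unshelve. all: by end_near. Qed.

(** * Estimates in L^2 and in W^{1,2} *)

Local Notation mu := (@lebesgue_measure _).

Section L2.
Context {R : realType}.
Implicit Types (u w m h : R -> R).

Definition L2norm u : R := Num.sqrt (ip u u).

Lemma L2norm_ge0 u : 0 <= L2norm u.
Proof. exact: sqrtr_ge0. Qed.

Lemma sqr_L2norm u : L2norm u ^+ 2 = ip u u.
Proof. by rewrite sqr_sqrtr// ip_ge0. Qed.

Lemma sqint_cst (c : R) : sq_integrable (cst c).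
Proof.
by apply: sqint_continuous; apply: continuous_subspaceT => t; exact: cvg_cst.
Qed.

Lemma ip0l h : ip (cst 0) h = 0.
Proof.
transitivity (ip (cst (0 : R)) (cst 0)); last by rewrite ip_cst mul0r.
by apply: eq_Rintegral => t _; rewrite !mul0r.
Qed.

(** The quadratic form (a, b) |-> |a u + b w|^2 is nonnegative. *)
Lemma ip_Cauchy_Schwarz u w : sq_integrable u -> sq_integrable w ->
  `|ip u w| <= L2norm u * L2norm w.
Proof.
move=> Lu Lw.
have quad a b : 0 <= a ^+ 2 * ip u u + 2 * a * b * ip u w + b ^+ 2 * ip w w.
  have L0 := sqint_cst 0.
  have Lbw : sq_integrable (fun t => b * w t + cst 0 t) by exact: sqint_lin.
  have := ip_ge0 (fun t => a * u t + (b * w t + cst 0 t)).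
  rewrite ip_linl//; last exact: sqint_lin.
  rewrite !(ipC _ (fun t => a * u t + _)) !ip_linl// !ip0l.
  rewrite !(ipC _ (fun t => b * w t + _)) !ip_linl// !ip0l (ipC w u); lra.
have : ip u w ^+ 2 <= ip u u * ip w w.
  have [uu|] := ltP 0 (ip u u).
    have := quad (- ip u w) (ip u u).
    rewrite (_ : _ + _ = ip u u * (ip u u * ip w w - ip u w ^+ 2)); last by ring.
    by rewrite pmulr_rge0// subr_ge0.
  have := ip_ge0 u => u0 u0'; have uu : ip u u = 0 by lra.
  rewrite uu mul0r; have [->|uw] := eqVneq (ip u w) 0; first by rewrite expr0n.
  have := quad (- (1 + ip w w) / (2 * ip u w)) 1; rewrite uu.
  have -> : 2 * (- (1 + ip w w) / (2 * ip u w)) * 1 * ip u w = - (1 + ip w w).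
    by field.
  lra.
move=> h; rewrite -(@ler_pXn2r _ 2)// ?nnegrE ?mulr_ge0 ?L2norm_ge0//.
by rewrite exprMn !sqr_L2norm real_normK ?num_real.
Qed.

Lemma continuous_I01_bounded m : {within I01, continuous m} ->
  exists2 M, 0 < M & forall t, I01 t -> `|m t| <= M.
Proof.
move=> cm.
have := compact_bounded (continuous_compact cm (@segment_compact R 0 1)).
move=> [M0 [_ hM]]; exists (`|M0| + 1) => [|t It]; first by rewrite ltr_wpDl.
apply: (hM (`|M0| + 1)); last by exists t.
by rewrite ltr_pwDr// ler_norm.
Qed.

Lemma sqint_mul_continuous m u : {within I01, continuous m} -> sq_integrable u ->
  sq_integrable (fun t => m t * u t).
Proof.
move=> cm [mu_ u2]; have [M M0 mM] := continuous_I01_bounded cm.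
have mm : measurable_fun I01 m.
  by apply: subspace_continuous_measurable_fun => //; exact: measurable_I01.
split; first exact: measurable_funM.
have Mi : mu.-integrable I01 (EFin \o (fun t => M ^+ 2 * u t ^+ 2)).
  by apply: integrableZl_EFin => //; exact: measurable_I01.
apply: le_integrable Mi => //; first exact: measurable_I01.
  by apply/measurable_EFinP; apply: measurable_funX; exact: measurable_funM.
move=> t It /=; rewrite lee_fin (ger0_norm (sqr_ge0 (_ * _))).
rewrite (ger0_norm (mulr_ge0 (sqr_ge0 M) (sqr_ge0 (u t)))).
rewrite exprMn ler_wpM2r ?sqr_ge0// -[leLHS]real_normK ?num_real//.
by rewrite lerXn2r ?nnegrE ?(ltW M0)// mM.
Qed.

Lemma L2norm_mul_le m u M : {within I01, continuous m} -> sq_integrable u ->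
  0 <= M -> (forall t, I01 t -> `|m t| <= M) ->
  L2norm (fun t => m t * u t) <= M * L2norm u.
Proof.
move=> cm Lu M0 mM; have Lmu := sqint_mul_continuous cm Lu.
rewrite -(@ler_pXn2r _ 2)// ?nnegrE ?mulr_ge0 ?L2norm_ge0//.
rewrite exprMn !sqr_L2norm /ip -RintegralZl; last 2 first.
- exact: measurable_I01.
- exact: sqint_mul.
apply: le_Rintegral => [||| t It].
- exact: measurable_I01.
- exact: sqint_mul.
- by apply: integrableZl_EFin; [exact: measurable_I01|exact: sqint_mul].
rewrite mulrACA -!expr2 ler_wpM2r ?sqr_ge0// -[leLHS]real_normK ?num_real//.
by rewrite lerXn2r ?nnegrE// mM.
Qed.

(** The trilinear form (m, u, w) |-> int m u w on C([0, 1]) x L^2 x L^2. *)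
Definition tri m u w : R := ip (fun t => m t * u t) w.

Lemma tri_le m u w M : {within I01, continuous m} -> sq_integrable u ->
  sq_integrable w -> 0 <= M -> (forall t, I01 t -> `|m t| <= M) ->
  `|tri m u w| <= M * (L2norm u * L2norm w).
Proof.
move=> cm Lu Lw M0 mM; have Lmu := sqint_mul_continuous cm Lu.
apply: (le_trans (ip_Cauchy_Schwarz Lmu Lw)); rewrite mulrA.
by rewrite ler_wpM2r ?L2norm_ge0//; exact: L2norm_mul_le.
Qed.

Lemma triC m u w : tri m u w = tri m w u.
Proof. by apply: eq_Rintegral => t _; rewrite mulrAC. Qed.

Lemma eq_tri m m' u w : (forall t, I01 t -> m t = m' t) -> tri m u w = tri m' u w.
Proof. by move=> mm; apply: eq_Rintegral => t /set_mem/mm ->. Qed.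

Lemma tri_linl (a : R) m m' u w : {within I01, continuous m} ->
  {within I01, continuous m'} -> sq_integrable u -> sq_integrable w ->
  tri (fun t => a * m t + m' t) u w = a * tri m u w + tri m' u w.
Proof.
move=> cm cm' Lu Lw; rewrite /tri -ip_linl//; try exact: sqint_mul_continuous.
by apply: eq_Rintegral => t _; congr (_ * _); ring.
Qed.

Lemma tri_ae m u u' w : {within I01, continuous m} -> sq_integrable u ->
  sq_integrable u' -> sq_integrable w -> ae_eq mu I01 u u' ->
  tri m u w = tri m u' w.
Proof.
move=> cm Lu Lu' Lw uu'; apply: ip_ae => //; try exact: sqint_mul_continuous.
by apply: filterS uu' => t h It; rewrite h.
Qed.

Lemma tri_linm (a : R) m u u' w : {within I01, continuous m} ->
  sq_integrable u -> sq_integrable u' -> sq_integrable w ->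
  tri m (fun t => a * u t + u' t) w = a * tri m u w + tri m u' w.
Proof.
move=> cm Lu Lu' Lw; rewrite /tri -ip_linl//; try exact: sqint_mul_continuous.
by apply: eq_Rintegral => t _; congr (_ * _); ring.
Qed.

Lemma tri_linr (a : R) m u w w' : {within I01, continuous m} ->
  sq_integrable u -> sq_integrable w -> sq_integrable w' ->
  tri m u (fun t => a * w t + w' t) = a * tri m u w + tri m u w'.
Proof. by move=> cm Lu Lw Lw'; rewrite triC tri_linm// !(triC m u). Qed.

End L2.

Section Indicator.
Context {R : realType} (s t : R).
Hypotheses (s0 : 0 <= s) (t1 : t <= 1).

Lemma I01_setI_itv : I01 `&` `]s, t] = `]s, t]%classic.
Proof.
apply/seteqP; split=> [r []//|r /= rst]; split=> //; move: rst.
rewrite /I01 /= !in_itv /= => /andP[sr rt].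
by rewrite (le_trans s0 (ltW sr)) (le_trans rt).
Qed.

End Indicator.

Lemma sqint_indic_itv {R : realType} (s t : R) :
  sq_integrable (\1_`]s, t] : R -> R).
Proof.
have mg : measurable_fun (@I01 R) (\1_`]s, t] : R -> R) by exact: measurable_indic.
split=> //; apply: le_integrable (integrable_cst01 (1 : R)).
- exact: measurable_I01.
- by apply/measurable_EFinP; exact: measurable_funX.
- move=> r _ /=; rewrite lee_fin normr1 indicE.
  by case: (_ \in _); rewrite ?expr1n ?expr0n ?normr0 ?normr1.
Qed.

Lemma ip_indic_itv {R : realType} (s t : R) : 0 <= s -> s <= t -> t <= 1 ->
  ip (\1_`]s, t]) (\1_`]s, t] : R -> R) = t - s.
Proof.
move=> s0 st t1; transitivity (\int[mu]_(r in `]s, t]) cst 1 r).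
  rewrite -[in RHS](I01_setI_itv s0 t1) Rintegral_mkcondr.
  apply: eq_Rintegral => r _; rewrite patchE !indicE.
  by case: ifP => _; rewrite ?mul1r ?mul0r.
have mE : mu `]s, t] = (t - s)%:E.
  rewrite lebesgue_measure_itv /= lte_fin.
  by move: st; rewrite le_eqVlt => /predU1P[->|->//]; rewrite ltxx subrr.
by rewrite Rintegral_cst// mul1r -[RHS]/(fine (t - s)%:E); congr fine; exact: mE.
Qed.

Section RowNorm.
Context {R : realType} {n : nat}.
Implicit Type v : 'rV[R]_n.

Lemma rV_coord_le v i : `|v 0 i| <= `|v|.
Proof.
rewrite [leRHS]mx_normrE; exact: (le_bigmax _ (fun ij => `|v ij.1 ij.2|) (0, i)).
Qed.

Lemma rV_norm_le v e : 0 <= e -> (forall i, `|v 0 i| <= e) -> `|v| <= e.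
Proof.
move=> e0 ve; rewrite [leLHS]mx_normrE; apply: bigmax_le => // -[i j] _ /=.
by rewrite ord1.
Qed.

End RowNorm.

Section Embedding.
Context {R : realType} {n : nat}.
Implicit Types (x y xi : W12 R n).

Lemma sqr_W12norm x : `|x| ^+ 2 = \sum_i (L2norm (fun t => x t 0 i) ^+ 2 +
  L2norm (fun t => weak_derivative x t 0 i) ^+ 2).
Proof.
rewrite -[`|x|]/(W12norm x) sqr_sqrtr.
  apply: eq_bigr => i _; rewrite !sqr_L2norm.
  by congr (_ + _); apply: eq_Rintegral => t _; rewrite expr2.
apply: sumr_ge0 => i _; apply: addr_ge0; apply: Rintegral_ge0 => t _;
  exact: sqr_ge0.
Qed.

Lemma W12norm_coord x i : L2norm (fun t => x t 0 i) ^+ 2 +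
  L2norm (fun t => weak_derivative x t 0 i) ^+ 2 <= `|x| ^+ 2.
Proof.
rewrite sqr_W12norm (bigD1 i)//= lerDl.
by apply: sumr_ge0 => j _; rewrite addr_ge0// sqr_ge0.
Qed.

Lemma L2norm_weak_derivative_le x i :
  L2norm (fun t => weak_derivative x t 0 i) <= `|x|.
Proof.
rewrite -(@ler_pXn2r _ 2)// ?nnegrE ?L2norm_ge0//.
by apply: le_trans (W12norm_coord x i); rewrite lerDr sqr_ge0.
Qed.

Lemma L2norm_coord_le x i : L2norm (fun t => x t 0 i) <= `|x|.
Proof.
rewrite -(@ler_pXn2r _ 2)// ?nnegrE ?L2norm_ge0//.
by apply: le_trans (W12norm_coord x i); rewrite lerDl sqr_ge0.
Qed.

(** Cauchy-Schwarz applied to x(t) - x(s) = int_s^t x'. *)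
Lemma W12_hoelder x i (s t : R) : 0 <= s -> s <= t -> t <= 1 ->
  `|x t 0 i - x s 0 i| <=
  Num.sqrt (t - s) * L2norm (fun t => weak_derivative x t 0 i).
Proof.
move=> s0 st t1; set v := fun t => _.
have [Lv xv] := weak_derivativeP x.
have It : I01 t by rewrite /I01 /= in_itv /= (le_trans s0 st).
have Is : I01 s by rewrite /I01 /= in_itv /= s0 (le_trans st).
rewrite (xv i t It) (xv i s Is) opprD addrACA subrr add0r Rintegral_itvB//.
  rewrite (_ : \int[mu]_(r in `]s, t]) v r = ip \1_`]s, t] v).
    apply: (le_trans (ip_Cauchy_Schwarz (sqint_indic_itv s t) (Lv i))).
    by rewrite /L2norm (ip_indic_itv s0 st t1).
  rewrite -[in LHS](I01_setI_itv s0 t1) Rintegral_mkcondr.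
  by apply: eq_Rintegral => r _; rewrite patchE indicE; case: ifP => _;
    rewrite ?mul1r ?mul0r.
exact: (integrable_I0t It (Lv i)).
Qed.

(** Integrate |x(0)|^2 <= 2 |x(t)|^2 + 2 |x'|_2^2 over t in [0, 1]. *)
Lemma W12_coord0_le x i : `|x 0 0 i| <= 2 * `|x|.
Proof.
have I0 : @I01 R 0 by rewrite /I01 /= in_itv /= lexx ler01.
have Lx := W12_sqint x i; have Lc := sqint_cst `|x|.
have L2 : mu.-integrable I01 (EFin \o (fun t => 2 * (x t 0 i * x t 0 i))).
  by apply: integrableZl_EFin; [exact: measurable_I01|exact: sqint_mul].
have L3 : mu.-integrable I01 (EFin \o (fun t : R => 2 * (cst `|x| t * cst `|x| t))).
  by apply: integrableZl_EFin; [exact: measurable_I01|exact: sqint_mul].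
have h : ip (cst (x 0 0 i)) (cst (x 0 0 i)) <=
    2 * ip (fun t => x t 0 i) (fun t => x t 0 i) + 2 * ip (cst `|x|) (cst `|x|).
  rewrite /ip -!RintegralZl; last 4 first.
  - exact: measurable_I01.
  - exact: sqint_mul.
  - exact: measurable_I01.
  - exact: sqint_mul.
  rewrite -RintegralD//; last exact: measurable_I01.
  apply: le_Rintegral => [||| t It].
  - exact: measurable_I01.
  - by apply: sqint_mul; exact: sqint_cst.
  - rewrite (_ : _ \o _ =
      (EFin \o (fun t => 2 * (x t 0 i * x t 0 i))%R) \+
      (EFin \o (fun t : R => 2 * (cst `|x| t * cst `|x| t))%R))%E.
      by apply: integrableD => //; exact: measurable_I01.
    by apply/funext.
  have /andP[t0 t1] : 0 <= t <= 1 by move: It; rewrite /I01 /= in_itv.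
  have := W12_hoelder x i (lexx 0) t0 t1; rewrite subr0 => h.
  have {}h : `|x t 0 i - x 0 0 i| <= `|x|.
    apply: (le_trans h); rewrite -[leRHS]mul1r ler_pM ?sqrtr_ge0 ?L2norm_ge0//.
      by rewrite -[leRHS]sqrtr1 ler_wsqrtr.
    exact: L2norm_weak_derivative_le.
  rewrite /= -!expr2.
  have : (x t 0 i - x 0 0 i) ^+ 2 <= `|x| ^+ 2.
    by rewrite -[leLHS]real_normK ?num_real// lerXn2r ?nnegrE.
  have := sqr_ge0 (x t 0 i - (x t 0 i - x 0 0 i) - 2 * x t 0 i + x 0 0 i).
  have := sqr_ge0 (2 * x t 0 i - x 0 0 i); nra.
rewrite !ip_cst -sqr_L2norm -!expr2 in h.
rewrite -(@ler_pXn2r _ 2)// ?nnegrE ?mulr_ge0// real_normK ?num_real//.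
apply: (le_trans h); rewrite exprMn.
have : L2norm (fun t => x t 0 i) ^+ 2 <= `|x| ^+ 2.
  by rewrite lerXn2r ?nnegrE ?L2norm_ge0// L2norm_coord_le.
by rewrite expr2 [in leRHS]expr2; lra.
Qed.

(** Sobolev embedding of W^{1,2} into bounded functions. *)
Lemma W12_sup_le x t : `|x t| <= 3 * `|x|.
Proof.
have [It|It] := pselect (I01 t); last first.
  by have /asboolP[_ ->] := W12fun_in x; rewrite // normr0 mulr_ge0.
apply: rV_norm_le => [|i]; first by rewrite mulr_ge0.
have /andP[t0 t1] : 0 <= t <= 1 by move: It; rewrite /I01 /= in_itv.
have := W12_hoelder x i (lexx 0) t0 t1; rewrite subr0 => h.
have {}h : `|x t 0 i - x 0 0 i| <= `|x|.
  apply: (le_trans h); rewrite -[leRHS]mul1r ler_pM ?sqrtr_ge0 ?L2norm_ge0//.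
    by rewrite -[leRHS]sqrtr1 ler_wsqrtr.
  exact: L2norm_weak_derivative_le.
rewrite -[x t 0 i](subrK (x 0 0 i)) (le_trans (ler_normD _ _))//.
by have := W12_coord0_le x i; lra.
Qed.

Lemma W12_continuous x : {within I01, continuous (x : R -> 'rV[R]_n)}.
Proof.
have [Lv xv] := weak_derivativeP x; set v := weak_derivative x in Lv xv.
have cc i : {within I01, continuous (fun t => x t 0 i)}.
  have c : {within I01, continuous
      (fun t => x 0 0 i + \int[mu]_(s in `[0, t]) v s 0 i)}.
    move=> t; apply: cvgD; first exact: cvg_cst.
    exact: (parameterized_integral_continuous ler01 (sqint_int (Lv i))).
  apply: (subspace_eq_continuous _ c) => t; rewrite inE => It /=.
  exact/esym/xv.
move=> t; apply/cvgrPdist_le => e e0.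
have : \forall s \near (t : subspace I01), forall i, `|x t 0 i - x s 0 i| <= e.
  have FF : Filter (nbhs (t : subspace (@I01 R))) by exact: nbhs_filter.
  by apply: (@filter_forall _ _ _ _ FF) => i; have /cvgrPdist_le := cc i t; exact.
apply: filterS => s hs; apply: rV_norm_le => [|i]; first exact: ltW.
by rewrite !mxE; exact: hs.
Qed.

Lemma W12_coord_continuous x i : {within I01, continuous (fun t => x t 0 i)}.
Proof.
move=> t; apply: (@continuous_comp _ _ _ _ (fun M : 'rV[R]_n => M 0 i)).
  exact: W12_continuous.
exact: coord_continuous.
Qed.

End Embedding.

(** * Uniform Taylor expansion on compact sets *)

Lemma compact_uniform_continuity (R : realType) (V : normedModType R)
  (g : V -> R) (K : set V) : compact K -> continuous g ->
  forall e, 0 < e -> \forall d \near 0^'+, forall y, K y -> forall h, `|h| <= d ->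
    `|g (y + h) - g y| <= e.
Proof.
move=> /compact_near_coveringP cK cg e e0.
pose P (d : R) y := forall h, `|h| <= d -> `|g (y + h) - g y| <= e.
apply: (cK R 0^'+ P) => y Ky.
have e20 : 0 < e / 2 by rewrite divr_gt0.
have /cvgrPdist_le/(_ _ e20) cgy := cg y.
have /nbhs_normP[r /= r0 yr] : nbhs y (fun z => `|g y - g z| <= e / 2) by exact: cgy.
have r20 : 0 < r / 2 by rewrite divr_gt0.
exists (ball_ Num.norm y (r / 2), [set d | d < r / 2]) => /=.
  split; first by apply/nbhs_normP; exists (r / 2).
  by apply: nbhs_right_lt.
move=> [z d] /= [yz dr] h hd.
have h1 : `|g y - g z| <= e / 2 by apply: yr => /=; lra.
have h2 : `|g y - g (z + h)| <= e / 2.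
  by apply: yr; rewrite /= opprD addrA (le_lt_trans (ler_normB _ _))//; lra.
rewrite (_ : _ - _ = (g y - g z) - (g y - g (z + h))); last by ring.
by rewrite (le_trans (ler_normB _ _))//; lra.
Qed.

Section UniformTaylor.
Context {R : realType} {n : nat}.
Implicit Types (f g : 'rV[R]_n -> R) (K : set 'rV[R]_n).

Lemma diff_row f y h : 'd f y h = \sum_k h 0 k * 'd f y (delta_mx 0 k).
Proof.
rewrite {1}(row_sum_delta h) linear_sum; apply: eq_bigr => k _.
by rewrite linearZ.
Qed.

Lemma C1_continuous f : C1 f -> continuous f.
Proof. by move=> [df _] y; exact: differentiable_continuous. Qed.

(** By the mean value theorem the remainder is a difference of values of 'd f, which is
    uniformly continuous near K. *)
Lemma compact_uniform_Taylor f K : compact K -> C1 f ->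
  forall e, 0 < e -> \forall d \near 0^'+, forall y, K y -> forall h, `|h| <= d ->
    `|f (y + h) - f y - 'd f y h| <= e * `|h|.
Proof.
move=> cK [df cdf] e e0.
have e'0 : 0 < e / n.+1%:R by rewrite divr_gt0.
have H : \forall d \near (0 : R)^'+, forall k y, K y -> forall h, `|h| <= d ->
    `|'d f (y + h) (delta_mx 0 k) - 'd f y (delta_mx 0 k)| <= e / n.+1%:R.
  by apply: filter_forall => k; exact: compact_uniform_continuity.
apply: filterS H => d dP y Ky h hd.
have [c||c] := @MVT_segment R (fun s => f (y + s *: h))
  (fun s => 'd f (y + s *: h) h) 0 1 ler01.
- by move=> _; apply: is_derive_line.
- apply: derivable_within_continuous => c _.
  by have [] := is_derive_line (df (y + c *: h)).
rewrite in_itv /= => /andP[c0 c1]; rewrite scale0r scale1r addr0 subr0 mulr1 => ->.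
rewrite [X in `|X|](_ : _ = \sum_k h 0 k *
    ('d f (y + c *: h) (delta_mx 0 k) - 'd f y (delta_mx 0 k))); last first.
  have E1 := diff_row f (y + c *: h) h; have E2 := diff_row f y h.
  apply: etrans (congr2 (fun a b => a - b) E1 E2) _.
  by rewrite -sumrB; apply: eq_bigr => k _; rewrite mulrBr.
apply: (le_trans (ler_norm_sum _ _ _)).
apply: (@le_trans _ _ (\sum_(k < n) e / n.+1%:R * `|h|)).
  apply: ler_sum => k _; rewrite normrM mulrC.
  apply: ler_pM => //; last exact: rV_coord_le.
  apply: dP => //; rewrite normrZ ger0_norm//.
  by rewrite (le_trans _ hd)// ler_piMl.
rewrite sumr_const card_ord -mulrnAl ler_wpM2r// -mulr_natr mulrAC.
by rewrite ler_pdivrMr// ler_wpM2l ?(ltW e0)// ler_nat.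
Qed.

End UniformTaylor.

Section AffineL2.
Context {R : realType} {n : nat}.

(** [P] is an affine map from W^{1,2} to L^2 whose linear part [P0] has norm at most 1.
    An element of L^2 is represented by a function, so the identities only hold
    almost everywhere. The two cases that occur are x |-> x'_i and constant maps. *)
Record affine_L2 (P P0 : W12 R n -> R -> R) : Prop := AffineL2 {
  affine_L2_sqint : forall x, sq_integrable (P x);
  affine_L2_sqint0 : forall xi, sq_integrable (P0 xi);
  affine_L2_lin : forall a xi eta,
    ae_eq mu I01 (P0 (a *: xi + eta)) (fun t => a * P0 xi t + P0 eta t);
  affine_L2_add : forall x xi,
    ae_eq mu I01 (P (x + xi)) (fun t => 1 * P x t + P0 xi t);
  affine_L2_le : forall xi, L2norm (P0 xi) <= `|xi|
}.

Lemma affine_L2_deriv i : affine_L2 (fun x t => weak_derivative x t 0 i)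
  (fun x t => weak_derivative x t 0 i).
Proof.
have lin (a : R) (xi eta : W12 R n) : ae_eq mu I01
    (fun t => weak_derivative (a *: xi + eta) t 0 i)
    (fun t => a * weak_derivative xi t 0 i + weak_derivative eta t 0 i).
  have := weak_derivative_unique i (weak_derivativeP (a *: xi + eta))
    (weak_derivative_lin a (weak_derivativeP xi) (weak_derivativeP eta)).
  by apply: filterS => t h It; rewrite h// !mxE.
split=> //.
- by move=> x; exact: weak_derivative_sqint.
- by move=> x; exact: weak_derivative_sqint.
- by move=> x xi; have := lin 1 x xi; rewrite scale1r.
- by move=> xi; exact: L2norm_weak_derivative_le.
Qed.

Lemma affine_L2_cst u : sq_integrable u -> affine_L2 (fun=> u) (fun=> cst 0).
Proof.
move=> Lu; split=> //.
- by move=> _; exact: sqint_cst.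
- by move=> a _ _; apply: aeW => t _ /=; rewrite mulr0 addr0.
- by move=> _ _; apply: aeW => t _ /=; rewrite mul1r addr0.
- by move=> xi; rewrite /L2norm ip0l sqrtr0.
Qed.

End AffineL2.

(** * Integral functionals and their first differential *)

Section Weights.
Context {R : realType} {n : nat}.
Implicit Types (x xi : W12 R n) (f : 'rV[R]_n -> R) (g : R -> R).

Lemma continuous_weight f x : continuous f ->
  {within I01, continuous (fun t => f (x t))}.
Proof.
move=> cf t; apply: (@continuous_comp _ _ _ (x : subspace I01 -> 'rV[R]_n) f).
  exact: W12_continuous.
exact: cf.
Qed.

Lemma continuousM_I01 g g' : {within I01, continuous g} ->
  {within I01, continuous g'} -> {within I01, continuous (fun t => g t * g' t)}.
Proof. by move=> cg cg' t; apply: cvgM; [exact: cg|exact: cg']. Qed.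

Lemma continuousD_I01 g g' : {within I01, continuous g} ->
  {within I01, continuous g'} -> {within I01, continuous (fun t => g t + g' t)}.
Proof. by move=> cg cg' t; apply: cvgD; [exact: cg|exact: cg']. Qed.

Lemma continuous_diff_weight f x xi : C1 f ->
  {within I01, continuous (fun t => 'd f (x t) (xi t))}.
Proof.
move=> [df cdf]; rewrite (_ : (fun t => _) =
    fun t => \sum_k xi t 0 k * 'd f (x t) (delta_mx 0 k)); last first.
  by apply/funext => t; rewrite diff_row.
elim: (index_enum _) => [|k r IH].
  rewrite (_ : (fun t => _) = cst 0); last by apply/funext => t; rewrite big_nil.
  by apply: continuous_subspaceT => t; exact: cvg_cst.
rewrite (_ : (fun t => _) = fun t => xi t 0 k * 'd f (x t) (delta_mx 0 k) +
    \sum_(k <- r) xi t 0 k * 'd f (x t) (delta_mx 0 k)); last first.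
  by apply/funext => t; rewrite big_cons.
apply: continuousD_I01 => //; apply: continuousM_I01; first exact: W12_coord_continuous.
exact: (@continuous_weight (fun p => 'd f p (delta_mx 0 k)) x (cdf (delta_mx 0 k))).
Qed.

Lemma weight_bounded f x : continuous f ->
  exists2 M, 0 < M & forall t, I01 t -> `|f (x t)| <= M.
Proof. by move=> cf; exact/continuous_I01_bounded/continuous_weight. Qed.

Lemma diff_weight_bounded f x : C1 f ->
  exists2 M, 0 < M & forall t h, I01 t -> `|'d f (x t) h| <= M * `|h|.
Proof.
move=> [df cdf].
have /all_sig2[M M0 fM] k : {M : R | 0 < M &
    forall t, I01 t -> `|'d f (x t) (delta_mx 0 k)| <= M}.
  apply/cid2.
  exact: (@weight_bounded (fun p => 'd f p (delta_mx 0 k)) x (cdf (delta_mx 0 k))).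
exists (\sum_k M k + 1) => [|t h It].
  by rewrite ltr_wpDl// sumr_ge0// => k _; exact: ltW.
rewrite diff_row (le_trans (ler_norm_sum _ _ _))// mulrDl mul1r ler_wpDr//.
rewrite mulr_suml; apply: ler_sum => k _; rewrite normrM mulrC.
by apply: ler_pM => //; [exact: fM|exact: rV_coord_le].
Qed.

End Weights.

Section Block.
Context {R : realType} {n : nat}.
Implicit Types (f : 'rV[R]_n -> R) (g : R -> R) (P Q : W12 R n -> R -> R).

(** x |-> int_0^1 f(x) g P(x) Q(x); the weight g lets the derivatives of such a
    functional in a fixed direction be sums of functionals of the same shape. *)
Definition block f g P Q (x : W12 R n) : R :=
  tri (fun t => f (x t) * g t) (P x) (Q x).

Definition dblock f g P P0 Q Q0 (x xi : W12 R n) : R :=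
  tri (fun t => 'd f (x t) (xi t) * g t) (P x) (Q x) +
  (tri (fun t => f (x t) * g t) (P0 xi) (Q x) +
   tri (fun t => f (x t) * g t) (P x) (Q0 xi)).

Section First.
Variables (f : 'rV[R]_n -> R) (g : R -> R) (P P0 Q Q0 : W12 R n -> R -> R).
Hypotheses (C1f : C1 f) (cg : {within I01, continuous g}).
Hypotheses (aP : affine_L2 P P0) (aQ : affine_L2 Q Q0).

Let cfg x : {within I01, continuous (fun t => f ((x : W12 R n) t) * g t)}.
Proof. by apply: continuousM_I01 => //; exact/continuous_weight/C1_continuous. Qed.

Let cfgD (x xi : W12 R n) : {within I01, continuous (fun t => f (x t + xi t) * g t)}.
Proof.
rewrite (_ : (fun t => _) = fun t => f ((x + xi) t) * g t); first exact: cfg.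
by apply/funext.
Qed.

Let cdfg x xi : {within I01,
  continuous (fun t => 'd f ((x : W12 R n) t) ((xi : W12 R n) t) * g t)}.
Proof. by apply: continuousM_I01 => //; exact: continuous_diff_weight. Qed.

Let LP := affine_L2_sqint aP.
Let LQ := affine_L2_sqint aQ.
Let LP0 := affine_L2_sqint0 aP.
Let LQ0 := affine_L2_sqint0 aQ.

Lemma dblock_linear x a xi eta :
  dblock f g P P0 Q Q0 x (a *: xi + eta) =
  a * dblock f g P P0 Q Q0 x xi + dblock f g P P0 Q Q0 x eta.
Proof.
rewrite /dblock (@tri_ae _ _ (P0 (a *: xi + eta))
  (fun t => a * P0 xi t + P0 eta t))//; last 2 first.
- exact: sqint_lin.
- exact: (affine_L2_lin aP).
rewrite (triC _ (P x) (Q0 (a *: xi + eta))) (@tri_ae _ _ (Q0 (a *: xi + eta))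
  (fun t => a * Q0 xi t + Q0 eta t))//; last 2 first.
- exact: sqint_lin.
- exact: (affine_L2_lin aQ).
rewrite (@eq_tri _ _ (fun t => a * ('d f (x t) (xi t) * g t) +
    'd f (x t) (eta t) * g t)); last first.
  move=> t _; rewrite -[(a *: xi + eta) t]/(a *: xi t + eta t) linearP.
  by rewrite mulrDl -scalerAl.
rewrite !tri_linm// tri_linl// (triC _ (Q0 _)) (triC _ (Q0 eta)); ring.
Qed.

(** The first term is small by Taylor's formula, the next two because f(x + xi) - f(x)
    is uniformly small, and the last one is quadratic in the derivatives of xi. *)
Lemma block_expansion x xi :
  block f g P Q (x + xi) - block f g P Q x - dblock f g P P0 Q Q0 x xi =
  tri (fun t => (f (x t + xi t) - f (x t) - 'd f (x t) (xi t)) * g t) (P x) (Q x) +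
  (tri (fun t => (f (x t + xi t) - f (x t)) * g t) (P0 xi) (Q x) +
   tri (fun t => (f (x t + xi t) - f (x t)) * g t) (P x) (Q0 xi)) +
  tri (fun t => f (x t + xi t) * g t) (P0 xi) (Q0 xi).
Proof.
have cN (m : R -> R) : {within I01, continuous m} ->
    {within I01, continuous (fun t => -1 * m t)}.
  move=> cm; apply: continuousM_I01 => //.
  by apply: continuous_subspaceT => t; exact: cvg_cst.
have d1 u w : sq_integrable u -> sq_integrable w ->
    tri (fun t => (f (x t + xi t) - f (x t)) * g t) u w =
    tri (fun t => f (x t + xi t) * g t) u w - tri (fun t => f (x t) * g t) u w.
  move=> Lu Lw; rewrite -[RHS]addrC -mulN1r -tri_linl//.
  by apply: eq_tri => t _; ring.
have d2 u w : sq_integrable u -> sq_integrable w ->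
    tri (fun t => (f (x t + xi t) - f (x t) - 'd f (x t) (xi t)) * g t) u w =
    tri (fun t => f (x t + xi t) * g t) u w - tri (fun t => f (x t) * g t) u w
    - tri (fun t => 'd f (x t) (xi t) * g t) u w.
  move=> Lu Lw; rewrite -d1// -[RHS]addrC -mulN1r -tri_linl//.
    by apply: eq_tri => t _; ring.
  rewrite (_ : (fun t => _) = fun t => -1 * (f (x t) * g t) + f (x t + xi t) * g t).
    apply: continuousD_I01; first exact: cN.
    by [].
  by apply/funext => t; ring.
have cfgxi := @cfgD x xi.
have -> : block f g P Q (x + xi) = tri (fun t => f (x t + xi t) * g t)
    (fun t => 1 * P x t + P0 xi t) (fun t => 1 * Q x t + Q0 xi t).
  rewrite /block (@tri_ae _ _ (P (x + xi)) (fun t => 1 * P x t + P0 xi t))//;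
    last 2 first.
  - exact: sqint_lin.
  - exact: (affine_L2_add aP).
  rewrite triC (@tri_ae _ _ (Q (x + xi)) (fun t => 1 * Q x t + Q0 xi t))//;
    last 3 first.
  - exact: sqint_lin.
  - exact: sqint_lin.
  - exact: (affine_L2_add aQ).
  exact: triC.
rewrite tri_linm// ?tri_linr//; last exact: sqint_lin.
rewrite d2// !d1// /block /dblock; ring.
Qed.

Lemma dblock_bounded x :
  exists K, forall xi, `|dblock f g P P0 Q Q0 x xi| <= K * `|xi|.
Proof.
have [G G0 gG] := continuous_I01_bounded cg.
have [M M0 fM] := weight_bounded x (C1_continuous C1f).
have [D D0 dfD] := diff_weight_bounded x C1f.
have NP := L2norm_ge0 (P x); have NQ := L2norm_ge0 (Q x).
have [D3 DE] : exists D3, D3 = 3 * D by exists (3 * D).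
have D30 : 0 < D3 by rewrite DE mulr_gt0.
exists (D3 * G * (L2norm (P x) * L2norm (Q x)) +
  (M * G * L2norm (Q x) + M * G * L2norm (P x))) => xi.
rewrite /dblock !mulrDl (le_trans (ler_normD _ _))// lerD//.
  apply: (@le_trans _ _ (D3 * G * `|xi| * (L2norm (P x) * L2norm (Q x)))); last first.
    by rewrite [leRHS]mulrAC.
  apply: tri_le => //; first by rewrite !mulr_ge0// ltW.
  move=> t It; rewrite normrM mulrAC; apply: ler_pM => //; last exact: gG.
  apply: (le_trans (dfD _ _ It)); rewrite DE (mulrC 3) -mulrA.
  by apply: ler_pM => //; [exact: ltW|exact: W12_sup_le].
rewrite (le_trans (ler_normD _ _))// lerD//.
  apply: (@le_trans _ _ (M * G * (L2norm (P0 xi) * L2norm (Q x)))); last first.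
    rewrite [leRHS]mulrAC -[leRHS]mulrA ler_wpM2l ?mulr_ge0 ?(ltW M0) ?(ltW G0)//.
    by rewrite ler_wpM2r// (affine_L2_le aP).
  apply: tri_le => //; first by rewrite mulr_ge0// ltW.
  by move=> t It; rewrite normrM ler_pM ?fM ?gG.
apply: (@le_trans _ _ (M * G * (L2norm (P x) * L2norm (Q0 xi)))); last first.
  rewrite -[leRHS]mulrA ler_wpM2l ?mulr_ge0 ?(ltW M0) ?(ltW G0)//.
  by rewrite ler_wpM2l// (affine_L2_le aQ).
apply: tri_le => //; first by rewrite mulr_ge0// ltW.
by move=> t It; rewrite normrM ler_pM ?fM ?gG.
Qed.

Lemma is_diff_block x : is_diff x (block f g P Q) (dblock f g P P0 Q Q0 x).
Proof.
have [K dK] := dblock_bounded x.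
apply: (is_diff_from_bound (K := K)) => // [a xi eta|e e0].
  exact: dblock_linear.
have [G G0 gG] := continuous_I01_bounded cg.
have [M M0 fM] := weight_bounded x (C1_continuous C1f).
have NP := L2norm_ge0 (P x); have NQ := L2norm_ge0 (Q x).
(* The four estimates B1 to B4 bound the remainder by e1 S |xi|. *)
pose S := G * (3 * (L2norm (P x) * L2norm (Q x)) + (L2norm (Q x) + L2norm (P x)) +
  (M + 1)).
have S0 : 0 < S.
  rewrite mulr_gt0// ltr_wpDl ?addr_gt0//.
  by rewrite !addr_ge0// ?mulr_ge0.
pose e1 := Num.min 1 (e / S).
have e10 : 0 < e1 by rewrite lt_min ltr01 divr_gt0.
have e11 : e1 <= 1 by rewrite ge_min lexx.
have e1S : e1 * S <= e by rewrite -ler_pdivlMr// ge_min lexx orbT.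
have cK : compact [set x t | t in `[0, 1] : set R].
  by apply: continuous_compact; [exact: W12_continuous|exact: segment_compact].
have [d [d0 [dT dU]]] : exists d : R, 0 < d /\
   ((forall y, [set x t | t in `[0, 1] : set R] y -> forall h, `|h| <= d ->
     `|f (y + h) - f y - 'd f y h| <= e1 * `|h|) /\
   (forall y, [set x t | t in `[0, 1] : set R] y -> forall h, `|h| <= d ->
     `|f (y + h) - f y| <= e1)).
  near (0 : R)^'+ => d; exists d; split=> //; split.
    by near: d; exact: compact_uniform_Taylor.
  by near: d; apply: compact_uniform_continuity => //; exact: C1_continuous.
exists (Num.min (d / 3) e1); first by rewrite lt_min divr_gt0.
move=> xi; rewrite le_min => /andP[xid xie1].
have xit t : `|xi t| <= d.
  by rewrite (le_trans (W12_sup_le xi t))// mulrC -ler_pdivlMr.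
have dT' t : I01 t -> `|f (x t + xi t) - f (x t) - 'd f (x t) (xi t)| <=
    3 * e1 * `|xi|.
  move=> It; apply: (le_trans (dT _ _ _ (xit t))); first by exists t.
  rewrite (mulrC 3) -[leRHS]mulrA.
  by apply: ler_pM => //; [exact: ltW|exact: W12_sup_le].
have dU' t : I01 t -> `|f (x t + xi t) - f (x t)| <= e1.
  by move=> It; apply: dU; [exists t|exact: xit].
have fM' t : I01 t -> `|f (x t + xi t)| <= M + 1.
  move=> It; rewrite -[f _](subrK (f (x t))) addrC (le_trans (ler_normD _ _))//.
  by rewrite lerD ?fM// (le_trans (dU' _ It)).
have cfgxi := @cfgD x xi.
have cN (m : R -> R) : {within I01, continuous m} ->
    {within I01, continuous (fun t => -1 * m t)}.
  move=> cm; apply: continuousM_I01 => //.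
  by apply: continuous_subspaceT => t; exact: cvg_cst.
have c1 : {within I01, continuous (fun t => (f (x t + xi t) - f (x t)) * g t)}.
  rewrite (_ : (fun t => _) = fun t => f (x t + xi t) * g t + -1 * (f (x t) * g t)).
    by apply: continuousD_I01 => //; exact: cN.
  by apply/funext => t; ring.
have c2 : {within I01, continuous (fun t =>
    (f (x t + xi t) - f (x t) - 'd f (x t) (xi t)) * g t)}.
  rewrite (_ : (fun t => _) = fun t => (f (x t + xi t) - f (x t)) * g t +
      -1 * ('d f (x t) (xi t) * g t)).
    by apply: continuousD_I01 => //; exact: cN.
  by apply/funext => t; ring.
have nP := affine_L2_le aP xi; have nQ := affine_L2_le aQ xi.
have nP0 := L2norm_ge0 (P0 xi); have nQ0 := L2norm_ge0 (Q0 xi).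
rewrite block_expansion.
have B1 : `|tri (fun t => (f (x t + xi t) - f (x t) - 'd f (x t) (xi t)) * g t)
    (P x) (Q x)| <= 3 * e1 * `|xi| * G * (L2norm (P x) * L2norm (Q x)).
  apply: tri_le => //; first by rewrite !mulr_ge0// ltW.
  by move=> t It; rewrite normrM ler_pM ?dT' ?gG.
have B2 : `|tri (fun t => (f (x t + xi t) - f (x t)) * g t) (P0 xi) (Q x)| <=
    e1 * G * (`|xi| * L2norm (Q x)).
  apply: (@le_trans _ _ (e1 * G * (L2norm (P0 xi) * L2norm (Q x)))); last first.
    by rewrite ler_wpM2l ?mulr_ge0 ?(ltW e10) ?(ltW G0)// ler_wpM2r.
  apply: tri_le => //; first by rewrite mulr_ge0// ltW.
  by move=> t It; rewrite normrM ler_pM ?dU' ?gG.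
have B3 : `|tri (fun t => (f (x t + xi t) - f (x t)) * g t) (P x) (Q0 xi)| <=
    e1 * G * (L2norm (P x) * `|xi|).
  apply: (@le_trans _ _ (e1 * G * (L2norm (P x) * L2norm (Q0 xi)))); last first.
    by rewrite ler_wpM2l ?mulr_ge0 ?(ltW e10) ?(ltW G0)// ler_wpM2l.
  apply: tri_le => //; first by rewrite mulr_ge0// ltW.
  by move=> t It; rewrite normrM ler_pM ?dU' ?gG.
have B4 : `|tri (fun t => f (x t + xi t) * g t) (P0 xi) (Q0 xi)| <=
    (M + 1) * G * (e1 * `|xi|).
  apply: (@le_trans _ _ ((M + 1) * G * (L2norm (P0 xi) * L2norm (Q0 xi)))).
    apply: tri_le => //; first by rewrite mulr_ge0 ?addr_ge0// ltW.
    by move=> t It; rewrite normrM ler_pM ?fM' ?gG.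
  rewrite ler_wpM2l ?mulr_ge0 ?addr_ge0 ?(ltW M0) ?(ltW G0)// ler_pM//.
  exact: (le_trans nP).
apply: (@le_trans _ _ (e1 * S * `|xi|)); last by rewrite ler_wpM2r.
apply: (le_trans (ler_normD _ _)).
have T1 := ler_normD
  (tri (fun t => (f (x t + xi t) - f (x t) - 'd f (x t) (xi t)) * g t) (P x) (Q x))
 (tri (fun t => (f (x t + xi t) - f (x t)) * g t) (P0 xi) (Q x) +
   tri (fun t => (f (x t + xi t) - f (x t)) * g t) (P x) (Q0 xi)).
have T2 := ler_normD (tri (fun t => (f (x t + xi t) - f (x t)) * g t) (P0 xi) (Q x))
   (tri (fun t => (f (x t + xi t) - f (x t)) * g t) (P x) (Q0 xi)).
apply: (le_trans (lerD (le_trans T1 (lerD B1 (le_trans T2 (lerD B2 B3)))) B4)).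
rewrite le_eqVlt; apply/orP; left; apply/eqP; rewrite /S; ring.
Unshelve. all: by end_near. Qed.

End First.
End Block.

(** * Second differential of integral functionals *)

Lemma is_diff_sum (R : realType) (V : normedModType R) (I : Type) (r : seq I)
    (F : I -> V -> R) (dF : I -> V -> R) (p : V) :
  (forall i, is_diff p (F i) (dF i)) ->
  is_diff p (fun q => \sum_(i <- r) F i q) (fun h => \sum_(i <- r) dF i h).
Proof.
move=> FdF; elim: r => [|i r IH].
  rewrite (_ : (fun q => \sum_(i <- [::]) F i q) = cst 0); last first.
    by apply/funext => q; rewrite big_nil.
  rewrite (_ : (fun h => \sum_(i <- [::]) dF i h) = 0); last first.
    by apply/funext => h; rewrite big_nil.
  exact: is_diff_cst.
rewrite (_ : (fun q => \sum_(j <- i :: r) F j q) =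
    F i + (fun q => \sum_(j <- r) F j q)); last first.
  by apply/funext => q; rewrite big_cons.
rewrite (_ : (fun h => \sum_(j <- i :: r) dF j h) =
    dF i + (fun h => \sum_(j <- r) dF j h)); last first.
  by apply/funext => h; rewrite big_cons.
exact: is_diffD.
Qed.

Lemma continuous_sum_I01 (R : realType) (I : Type) (r : seq I) (m : I -> R -> R) :
  (forall i, {within I01, continuous (m i)}) ->
  {within I01, continuous (fun t => \sum_(i <- r) m i t)}.
Proof.
move=> cm; elim: r => [|k r IH].
  rewrite (_ : (fun t => \sum_(i <- [::]) m i t) = cst 0); last first.
    by apply/funext => t; rewrite big_nil.
  by apply: continuous_subspaceT => t; exact: cvg_cst.
rewrite (_ : (fun t => \sum_(j <- k :: r) m j t) =
    fun t => m k t + \sum_(j <- r) m j t); last first.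
  by apply/funext => t; rewrite big_cons.
exact: continuousD_I01.
Qed.

Lemma tri_sum (R : realType) (I : Type) (r : seq I) (m : I -> R -> R) u w :
  (forall i, {within I01, continuous (m i)}) ->
  sq_integrable u -> sq_integrable w ->
  tri (fun t => \sum_(i <- r) m i t) u w = \sum_(i <- r) tri (m i) u w.
Proof.
move=> cm Lu Lw; elim: r => [|i r IH].
  rewrite big_nil; transitivity (ip (cst 0) w); last exact: ip0l.
  by apply: eq_Rintegral => t _; rewrite big_nil mul0r.
rewrite big_cons -IH -[tri (m i) u w]mul1r -tri_linl//; last exact: continuous_sum_I01.
by apply: eq_tri => t _; rewrite big_cons mul1r.
Qed.

Section Second.
Context {R : realType} {n : nat}.
Variables (f : 'rV[R]_n -> R) (g : R -> R) (P P0 Q Q0 : W12 R n -> R -> R).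
Hypotheses (C2f : C2 f) (cg : {within I01, continuous g}).
Hypotheses (aP : affine_L2 P P0) (aQ : affine_L2 Q Q0).

Let partial (k : 'I_n) (y : 'rV[R]_n) : R := 'd f y (delta_mx 0 k).
Let weight (xi : W12 R n) k (t : R) := g t * xi t 0 k.

Let C1p k : C1 (partial k). Proof. exact: C2f.2. Qed.

Let cweight xi k : {within I01, continuous (weight xi k)}.
Proof. by apply: continuousM_I01 => //; exact: W12_coord_continuous. Qed.

Let LP := affine_L2_sqint aP.
Let LQ := affine_L2_sqint aQ.
Let LP0 := affine_L2_sqint0 aP.
Let LQ0 := affine_L2_sqint0 aQ.

Definition d2block (x xi eta : W12 R n) : R :=
  \sum_k dblock (partial k) (weight xi k) P P0 Q Q0 x eta +
  (dblock f g (fun=> P0 xi) (fun=> cst 0) Q Q0 x eta +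
   dblock f g P P0 (fun=> Q0 xi) (fun=> cst 0) x eta).

(** In a fixed direction xi, the first differential is a sum of functionals of the same
    kind: xi is absorbed in the weight, its derivative in a constant slot. *)
Lemma twice_diff_block x : twice_diff (block f g P Q) x /\
  forall xi eta, diff2 (block f g P Q) x xi eta = d2block x xi eta.
Proof.
have C1f := C2f.1.
have dd xi : is_diff x (fun q => dblock f g P P0 Q Q0 q xi) (d2block x xi).
  rewrite (_ : (fun q => _) =
    (fun q => \sum_k block (partial k) (weight xi k) P Q q) +
    (block f g (fun=> P0 xi) Q + block f g P (fun=> Q0 xi))); last first.
    apply/funext => q; rewrite -[RHS]/(_ q + (_ q + _ q)) /dblock; congr (_ + _).
    rewrite -tri_sum//; last first.
      move=> k; have c1 := @continuous_weight _ _ _ q (C1_continuous (C1p k)).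
      exact: (continuousM_I01 c1 (@cweight xi k)).
    apply: eq_tri => t _; rewrite diff_row mulr_suml; apply: eq_bigr => k _.
    by rewrite /partial /weight; ring.
  rewrite (_ : d2block x xi =
    (fun eta => \sum_k dblock (partial k) (weight xi k) P P0 Q Q0 x eta) +
    (dblock f g (fun=> P0 xi) (fun=> cst 0) Q Q0 x +
     dblock f g P P0 (fun=> Q0 xi) (fun=> cst 0) x)); last by apply/funext.
  have h1 k := is_diff_block (C1p k) (@cweight xi k) aP aQ x.
  have h2 := is_diff_block C1f cg (affine_L2_cst (LP0 xi)) aQ x.
  have h3 := is_diff_block C1f cg aP (affine_L2_cst (LQ0 xi)) x.
  exact: (is_diffD (is_diff_sum _ h1) (is_diffD h2 h3)).
have [||tw E] := @twice_diff_intro _ _ (block f g P Q) (dblock f g P P0 Q Q0) x.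
- by near=> q; exact: is_diff_block.
- by move=> xi; have := @ex_diff _ _ _ _ _ _ _ (dd xi).
by split=> // xi eta; rewrite E (@diff_val _ _ _ _ _ _ _ (dd xi)).
Unshelve. all: by end_near. Qed.

(** When the sup norm of xi is much smaller than its W^{1,2} norm, only the term of
    the second variation that has derivatives of xi in both slots survives. *)
Lemma d2block_principal x : exists2 C, 0 <= C & forall (xi : W12 R n) (d : R),
  0 <= d <= 1 -> (forall t, `|xi t| <= d * `|xi|) ->
  `|d2block x xi xi - 2 * tri (fun t => f (x t) * g t) (P0 xi) (Q0 xi)|
    <= C * (d * `|xi| ^+ 2).
Proof.
have C1f := C2f.1.
have [G G0 gG] := continuous_I01_bounded cg.
have [D D0 dfD] := diff_weight_bounded x C1f.
have /all_sig2[M M0 pM] k : {M : R | 0 < M &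
    forall t, I01 t -> `|partial k (x t)| <= M}.
  exact: (cid2 (weight_bounded x (C1_continuous (C1p k)))).
have /all_sig2[E E0 pE] k : {E : R | 0 < E &
    forall t h, I01 t -> `|'d (partial k) (x t) h| <= E * `|h|}.
  exact: (cid2 (diff_weight_bounded x (C1p k))).
have NP := L2norm_ge0 (P x); have NQ := L2norm_ge0 (Q x).
pose a := L2norm (P x); pose b := L2norm (Q x).
exists (\sum_k (E k * G * a * b + (M k * G * b + M k * G * a)) + (D * G * b + D * G * a)).
  rewrite addr_ge0//; last by rewrite addr_ge0 ?mulr_ge0 ?(ltW D0) ?(ltW G0).
  apply: sumr_ge0 => k _.
  by rewrite !addr_ge0 ?mulr_ge0 ?(ltW (E0 k)) ?(ltW (M0 k)) ?(ltW G0).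
move=> xi d /andP[d0 d1] xid.
have N0 : 0 <= `|xi| by [].
have dN0 : 0 <= d * `|xi| by rewrite mulr_ge0.
have nP := affine_L2_le aP xi; have nQ := affine_L2_le aQ xi.
have nP0 := L2norm_ge0 (P0 xi); have nQ0 := L2norm_ge0 (Q0 xi).
have wle k t : I01 t -> `|weight xi k t| <= G * (d * `|xi|).
  move=> It; rewrite normrM; apply: ler_pM => //; first exact: gG.
  exact: le_trans (rV_coord_le _ _) (xid t).
have dle t : I01 t -> `|'d f (x t) (xi t) * g t| <= D * (d * `|xi|) * G.
  move=> It; rewrite normrM; apply: ler_pM => //; last exact: gG.
  by apply: (le_trans (dfD _ _ It)); apply: ler_pM => //; exact: ltW.
have cdf : {within I01, continuous (fun t => 'd f (x t) (xi t) * g t)}.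
  by apply: continuousM_I01 => //; exact: continuous_diff_weight.
have L0 : sq_integrable (cst (0 : R)) by exact: sqint_cst.
have tri0 m w : tri m (cst 0) w = 0 :> R.
  rewrite /tri -[RHS](ip0l w); apply: eq_Rintegral => t _.
  by rewrite mulr0.
have -> : d2block x xi xi - 2 * tri (fun t => f (x t) * g t) (P0 xi) (Q0 xi) =
  \sum_k dblock (partial k) (weight xi k) P P0 Q Q0 x xi +
  (tri (fun t => 'd f (x t) (xi t) * g t) (P0 xi) (Q x) +
   tri (fun t => 'd f (x t) (xi t) * g t) (P x) (Q0 xi)).
  rewrite /d2block /dblock tri0 (triC _ (P x) (cst 0)) tri0; ring.
apply: (le_trans (ler_normD _ _)); rewrite mulrDl; apply: lerD.
  apply: (le_trans (ler_norm_sum _ _ _)); rewrite mulr_suml.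
  apply: ler_sum => k _; rewrite /dblock.
  apply: (le_trans (ler_normD _ _)); rewrite mulrDl; apply: lerD.
    have cc : {within I01, continuous
        (fun t => 'd (partial k) (x t) (xi t) * weight xi k t)}.
      exact: (continuousM_I01 (@continuous_diff_weight _ _ _ x xi (C1p k)) (@cweight xi k)).
    have bb t : I01 t -> `|'d (partial k) (x t) (xi t) * weight xi k t| <=
        E k * `|xi| * (G * (d * `|xi|)).
      move=> It; rewrite normrM; apply: ler_pM => //; last exact: wle.
      apply: (le_trans (pE _ _ _ It)); apply: ler_pM => //; first exact/ltW/E0.
      by rewrite (le_trans (xid t))// ler_piMl.
    have := tri_le cc (LP x) (LQ x) _ bb.
    rewrite !mulr_ge0 ?(ltW (E0 k)) ?(ltW G0)// => /(_ isT)/le_trans; apply.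
    by rewrite le_eqVlt; apply/orP; left; apply/eqP; rewrite /a /b; ring.
  have cc : {within I01, continuous (fun t => partial k (x t) * weight xi k t)}.
    have c1 := @continuous_weight _ _ _ x (C1_continuous (C1p k)).
    exact: (continuousM_I01 c1 (@cweight xi k)).
  have bb t : I01 t -> `|partial k (x t) * weight xi k t| <=
      M k * (G * (d * `|xi|)).
    by move=> It; rewrite normrM; apply: ler_pM => //; [exact: pM|exact: wle].
  have MG : 0 <= M k * (G * (d * `|xi|)) by rewrite !mulr_ge0 ?(ltW (M0 k)) ?(ltW G0).
  apply: (le_trans (ler_normD _ _)); rewrite mulrDl; apply: lerD.
    apply: (le_trans (tri_le cc (LP0 xi) (LQ x) MG bb)).
    apply: (@le_trans _ _ (M k * (G * (d * `|xi|)) * (`|xi| * b))).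
      by apply: ler_pM => //; [rewrite mulr_ge0|apply: ler_pM].
    by rewrite le_eqVlt; apply/orP; left; apply/eqP; ring.
  apply: (le_trans (tri_le cc (LP x) (LQ0 xi) MG bb)).
  apply: (@le_trans _ _ (M k * (G * (d * `|xi|)) * (a * `|xi|))).
    by apply: ler_pM => //; [rewrite mulr_ge0|apply: ler_pM].
  by rewrite le_eqVlt; apply/orP; left; apply/eqP; ring.
have DG : 0 <= D * (d * `|xi|) * G by rewrite !mulr_ge0 ?(ltW D0) ?(ltW G0).
apply: (le_trans (ler_normD _ _)); rewrite mulrDl; apply: lerD.
  apply: (le_trans (tri_le cdf (LP0 xi) (LQ x) DG dle)).
  apply: (@le_trans _ _ (D * (d * `|xi|) * G * (`|xi| * b))).
    by apply: ler_pM => //; [rewrite mulr_ge0|apply: ler_pM].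
  by rewrite le_eqVlt; apply/orP; left; apply/eqP; ring.
apply: (le_trans (tri_le cdf (LP x) (LQ0 xi) DG dle)).
apply: (@le_trans _ _ (D * (d * `|xi|) * G * (a * `|xi|))).
  by apply: ler_pM => //; [rewrite mulr_ge0|apply: ler_pM].
by rewrite le_eqVlt; apply/orP; left; apply/eqP; ring.
Qed.

End Second.

(** * Coercivity and sampling *)

Section Sampling.
Context {R : realType} {n : nat}.
Implicit Types (xi : W12 R n).

Lemma sample_bracket (m : nat) (t : R) : 0 <= t <= 1 ->
  exists i : 'I_m.+1, i%:R / m.+1%:R <= t <= i.+1%:R / m.+1%:R.
Proof.
move=> /andP[t0 t1]; pose p k := t <= k.+1%:R / m.+1%:R.
have exp : exists k, p k by exists m; rewrite /p divff ?pnatr_eq0.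
have [k pk kmin] := ex_minnP exp.
have km : (k < m.+1)%N by rewrite ltnS; apply: kmin; rewrite /p divff ?pnatr_eq0.
exists (Ordinal km) => /=; rewrite -/(p k) pk andbT.
case: k pk kmin {km} => [|k] _ kmin; first by rewrite mul0r.
by rewrite leNgt; apply/negP => /ltW /kmin; rewrite ltnn.
Qed.

(** Every point of [0, 1] is within 1 / (m + 1) of a sample point, and W^{1,2} functions
    are Hoelder continuous of exponent 1/2. *)
Lemma W12_sampled_sup_le m xi :
  (forall i : 'I_m.+1, xi (i%:R / m.+1%:R) = 0) ->
  forall t, `|xi t| <= Num.sqrt (m.+1%:R^-1) * `|xi|.
Proof.
move=> xi0 t; have [It|It] := pselect (I01 t); last first.
  by have /asboolP[_ ->] := W12fun_in xi; rewrite // normr0 mulr_ge0 ?sqrtr_ge0.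
have t01 : 0 <= t <= 1 by move: It; rewrite /I01 /= in_itv.
have [i /andP[it ti]] := sample_bracket m t01.
apply: rV_norm_le => [|j]; first by rewrite mulr_ge0 ?sqrtr_ge0.
have /andP[_ t1] := t01.
have := W12_hoelder xi j (divr_ge0 (ler0n _ _) (ler0n _ _)) it t1.
rewrite xi0 [(0 : 'rV_n) 0 j]mxE subr0 => /le_trans; apply.
apply: ler_pM; rewrite ?sqrtr_ge0 ?L2norm_ge0//; last exact: L2norm_weak_derivative_le.
by apply: ler_wsqrtr; rewrite lerBlDr (le_trans ti)// -natr1 mulrDl mul1r addrC.
Qed.

(** Where the sup norm is small, the W^{1,2} norm sits in the derivative. *)
Lemma W12norm_le_deriv xi (d : R) : 0 <= d <= 1 ->
  (forall t, `|xi t| <= d * `|xi|) ->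
  (1 - n%:R * d) * `|xi| ^+ 2 <=
  \sum_i L2norm (fun t => weak_derivative xi t 0 i) ^+ 2.
Proof.
move=> /andP[d0 d1] xid.
have coord i : L2norm (fun t => xi t 0 i) ^+ 2 <= d * `|xi| ^+ 2.
  rewrite sqr_L2norm; have Lc := sqint_cst (d * `|xi|).
  apply: (@le_trans _ _ (ip (cst (d * `|xi|)) (cst (d * `|xi|)))).
    apply: le_Rintegral => [||| t _].
    - exact: measurable_I01.
    - by apply: sqint_mul; exact: W12_sqint.
    - exact: sqint_mul.
    rewrite /= -!expr2 -[leLHS]real_normK ?num_real// lerXn2r ?nnegrE ?mulr_ge0//.
    exact: le_trans (rV_coord_le _ _) (xid t).
  rewrite ip_cst -expr2 exprMn ler_wpM2r ?sqr_ge0//.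
  by rewrite expr2 ler_piMl.
rewrite mulrBl mul1r {1}sqr_W12norm big_split /= lerBlDr [leLHS]addrC lerD2l.
apply: (@le_trans _ _ (\sum_(i < n) d * `|xi| ^+ 2)).
  by apply: ler_sum => i _; exact: coord.
by rewrite sumr_const card_ord -[leLHS]mulr_natl [leLHS]mulrA.
Qed.

(** If Q is coercive up to an error that is small for small sup norm, a vector on which
    Q vanishes is zero as soon as it vanishes at finitely many points. *)
Lemma coercive_sampled_eq0 (Q : W12 R n -> R) (k C : R) : 0 < k -> 0 <= C ->
  (forall xi (d : R), 0 <= d <= 1 -> (forall t, `|xi t| <= d * `|xi|) ->
    k * \sum_i L2norm (fun t => weak_derivative xi t 0 i) ^+ 2
      - C * (d * `|xi| ^+ 2) <= Q xi) ->
  exists m : nat, forall xi, (forall i : 'I_m.+1, xi (i%:R / m.+1%:R) = 0) ->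
    Q xi = 0 -> xi = 0.
Proof.
move=> k0 C0 coer.
pose S := k * n%:R + C + 1.
have S0 : 0 < S by rewrite ltr_wpDl// addr_ge0// mulr_ge0// ltW.
pose d0 := Num.min 1 (k / S).
have d00 : 0 < d0 by rewrite lt_min ltr01 divr_gt0.
have [m md] : exists m : nat, Num.sqrt (m.+1%:R^-1) <= d0.
  exists (Num.bound (d0 ^- 2)).
  rewrite -[leRHS]gtr0_norm// -sqrtr_sqr ler_wsqrtr//.
  rewrite -[leRHS]invrK lef_pV2 ?posrE ?invr_gt0 ?exprn_gt0//.
  have := archi_boundP (_ : 0 <= d0 ^- 2); rewrite invr_ge0 sqr_ge0 => /(_ isT).
  by move=> /ltW/le_trans; apply; rewrite ler_nat.
exists m => xi xi0 Qxi.
set d := Num.sqrt _ in md.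
have xid := W12_sampled_sup_le xi0.
have dd : 0 <= d <= 1.
  by rewrite sqrtr_ge0/= (le_trans md)// ge_min lexx.
have dS : d * S <= k by rewrite -ler_pdivlMr// (le_trans md)// ge_min lexx orbT.
have h1 := coer xi d dd xid; have h2 := W12norm_le_deriv dd xid.
have h3 := ler_wpM2l (ltW k0) h2; rewrite Qxi in h1.
have N0 := sqr_ge0 `|xi|.
case/andP: dd => d0' _.
have [/eqP|N] := eqVneq (`|xi| ^+ 2) 0.
  by rewrite expf_eq0 /= normr_eq0 => /eqP.
have d1 : 0 < d by rewrite sqrtr_gt0 invr_gt0.
have [N2 N2E] : exists N2 : R, N2 = `|xi| ^+ 2 by exists (`|xi| ^+ 2).
(* If xi <> 0, then h1 and h3 contradict d S <= k. *)
have N1 : 0 < N2 by rewrite N2E lt_neqAle eq_sym N N0.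
have h4 : 0 < (k - (k * n%:R + C) * d) * N2.
  by rewrite mulr_gt0// subr_gt0 (lt_le_trans _ dS)// mulrC ltr_pM2l// ltrDl.
by exfalso; rewrite -N2E in h1 h3; lra.
Qed.

Definition samples m (h : W12 R n * R) : 'rV[R]_(m.+1 * n + 1) :=
  row_mx (mxvec (\matrix_(i < m.+1, j < n) h.1 (i%:R / m.+1%:R) 0 j)) (const_mx h.2).

Lemma samples_linear m (a : R) h k :
  samples m (a *: h + k) = a *: samples m h + samples m k.
Proof.
rewrite /samples scale_row_mx add_row_mx -linearP; congr (row_mx (mxvec _) _).
  by apply/matrixP => i j; rewrite !mxE.
by apply/matrixP => i j; rewrite !mxE.
Qed.

Lemma samples_eq0 m h : samples m h = 0 ->
  h.2 = 0 /\ forall i : 'I_m.+1, h.1 (i%:R / m.+1%:R) = 0.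
Proof.
rewrite -[0 in X in X -> _](row_mx0 _ 1) => /eq_row_mx[h1 h2]; split.
  by have /rowP/(_ 0) := h2; rewrite !mxE.
move=> i; apply/rowP => j; rewrite [RHS]mxE.
have := congr1 vec_mx h1; rewrite mxvecK linear0 => /matrixP/(_ i j).
by rewrite !mxE.
Qed.

End Sampling.

(** * Coefficients of a Lagrangian quadratic in v *)

Section SmoothClosure.
Context {R : realType}.

Lemma C1_lin (V : normedModType R) (a : R) (f g : V -> R) :
  C1 f -> C1 g -> C1 (a *: f + g).
Proof.
move=> [df cf] [dg cg].
have dE p : is_diff p (a *: f + g) (a *: ('d f p : V -> R) + 'd g p).
  by apply: is_diffD; [apply: is_diffZ|]; exact: differentiableP.
split=> [p|h]; first by have := @ex_diff _ _ _ _ _ _ _ (dE p).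
rewrite (_ : (fun p => _) = fun p => a * 'd f p h + 'd g p h); last first.
  by apply/funext => p; rewrite (@diff_val _ _ _ _ _ _ _ (dE p)).
by move=> p; apply: cvgD; [apply: cvgM; [exact: cvg_cst|exact: cf]|exact: cg].
Qed.

Lemma C2_lin (V : normedModType R) (a : R) (f g : V -> R) :
  C2 f -> C2 g -> C2 (a *: f + g).
Proof.
move=> [C1f C2f] [C1g C2g]; split; first exact: C1_lin.
move=> h.
have -> : (fun p => 'd (a *: f + g) p h) =
    a *: (fun p => 'd f p h) + (fun p => 'd g p h).
  apply/funext => p.
  have dE : is_diff p (a *: f + g) (a *: ('d f p : V -> R) + 'd g p).
    by apply: is_diffD; [apply: is_diffZ|]; apply: differentiableP;
      [exact: C1f.1|exact: C1g.1].
  by rewrite (@diff_val _ _ _ _ _ _ _ dE).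
exact: (C1_lin a (C2f h) (C2g h)).
Qed.

Lemma C1_affine (U V : normedModType R) (f : V -> R) (g i : U -> V) :
  (forall q, is_diff q g i) -> C1 f -> C1 (f \o g).
Proof.
move=> gi [df cf].
have dg q : differentiable g q by have [] := gi q.
have dE q : is_diff q (f \o g) ('d f (g q) \o i).
  by apply: is_diff_comp; exact: differentiableP.
split=> [q|h]; first by have := @ex_diff _ _ _ _ _ _ _ (dE q).
have -> : (fun q => 'd (f \o g) q h) = (fun p => 'd f p (i h)) \o g.
  by apply/funext => q; rewrite (@diff_val _ _ _ _ _ _ _ (dE q)).
move=> q; apply: continuous_comp; first exact: differentiable_continuous.
exact: cf.
Qed.

Lemma C2_affine (U V : normedModType R) (f : V -> R) (g i : U -> V) :
  (forall q, is_diff q g i) -> C2 f -> C2 (f \o g).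
Proof.
move=> gi [C1f C2f]; split; first exact: C1_affine gi C1f.
move=> h; rewrite (_ : (fun q => _) = (fun p => 'd f p (i h)) \o g).
  exact: C1_affine gi (C2f _).
apply/funext => q; have dE : is_diff q (f \o g) ('d f (g q) \o i).
  by apply: is_diff_comp; apply: differentiableP; exact: C1f.1.
by rewrite (@diff_val _ _ _ _ _ _ _ dE).
Qed.

Lemma is_diff_pair_l (U V : normedModType R) (v : V) (q : U) :
  is_diff q (fun y => (y, v)) (fun h => (h, 0)).
Proof.
have := @is_diff_pair R U U V id id (cst v) 0 q.
by apply.
Qed.

End SmoothClosure.

Section Coefficients.
Context {R : realType} {n : nat}.
Implicit Types (L : 'rV[R]_n -> 'rV[R]_n -> R) (y v : 'rV[R]_n).

(** The monomials v_a v_b, v_a and 1, in this order. *)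
Definition monomial : finType := ('I_n * 'I_n + ('I_n + unit))%type.

Definition degree (i : monomial) : nat :=
  match i with inl _ => 2 | inr (inl _) => 1 | inr (inr _) => 0 end.

(** The variables of a monomial; [None] is a factor 1. *)
Definition slot1 (i : monomial) : option 'I_n :=
  match i with inl p => Some p.1 | inr (inl a) => Some a | inr (inr _) => None end.

Definition slot2 (i : monomial) : option 'I_n :=
  match i with inl p => Some p.2 | inr _ => None end.

Definition coord v (o : option 'I_n) : R := if o is Some a then v 0 a else 1.

(** The entry (a, b) of A + A^T, where v A v^T is the quadratic part of L. *)
Definition polar L (a b : 'I_n) y : R :=
  L y (delta_mx 0 a + delta_mx 0 b) - L y (delta_mx 0 a) - L y (delta_mx 0 b) + L y 0.

(** The coefficients are expressed by finitely many values of L, so that they inherit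
    the regularity of L in x. *)
Definition coef L (i : monomial) y : R :=
  match i with
  | inl p => 2^-1 * polar L p.1 p.2 y
  | inr (inl a) => 2^-1 * (L y (delta_mx 0 a) - L y (- delta_mx 0 a))
  | inr (inr _) => L y 0
  end.

Definition expands L := forall y v,
  L y v = \sum_i coef L i y * (coord v (slot1 i) * coord v (slot2 i)).

Lemma sum_monomial (F : monomial -> R) : \sum_i F i =
  \sum_a \sum_b F (inl (a, b)) + (\sum_a F (inr (inl a)) + F (inr (inr tt))).
Proof.
rewrite big_sumType big_sumType /= pair_bigA /=; congr (_ + (_ + _)).
  by apply: eq_bigr => -[].
by rewrite (big_pred1 tt)// => -[].
Qed.

Lemma quadratic_expands L : quadratic_in_v L -> expands L.
Proof.
move=> [A [b [c LE]]] y v.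
pose q (u w : 'rV[R]_n) := (u *m A y *m w^T) 0 0.
pose l (u : 'rV[R]_n) := (b y *m u^T) 0 0.
have qE u w : q u w = \sum_j (\sum_i u 0 i * A y i j) * w 0 j.
  by rewrite /q mxE; apply: eq_bigr => j _; rewrite !mxE.
have lE u : l u = \sum_j b y 0 j * u 0 j.
  by rewrite /l mxE; apply: eq_bigr => j _; rewrite !mxE.
have qD u u' w : q (u + u') w = q u w + q u' w by rewrite /q !mulmxDl mxE.
have qDr u w w' : q u (w + w') = q u w + q u w'.
  by rewrite /q linearD mulmxDr mxE.
have qN u w : q (- u) (- w) = q u w by rewrite /q linearN mulmxN !mulNmx opprK.
have lD u u' : l (u + u') = l u + l u' by rewrite /l linearD mulmxDr mxE.
have lN u : l (- u) = - l u by rewrite /l linearN mulmxN mxE.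
have q0 : q 0 0 = 0 by rewrite /q !mul0mx mxE.
have l0 : l 0 = 0 by rewrite /l trmx0 mulmx0 mxE.
have LE' u : L y u = q u u + l u + c y by exact: LE.
have qd i j : q (delta_mx 0 i) (delta_mx 0 j) = A y i j.
  by rewrite /q trmx_delta -rowE -colE !mxE.
have ld i : l (delta_mx 0 i) = b y 0 i by rewrite /l trmx_delta -colE mxE.
have pE i j : polar L i j y = A y i j + A y j i.
  by rewrite /polar !LE' !qD !qDr !lD q0 l0 !qd; ring.
rewrite sum_monomial /= !mulr1 LE' (LE' 0) q0 l0 !add0r addrA; congr (_ + _ + _).
  have qvv : q v v = \sum_i \sum_j A y i j * (v 0 i * v 0 j).
    rewrite qE exchange_big /=; apply: eq_bigr => j _; rewrite mulr_suml.
    by apply: eq_bigr => i _; ring.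
  have qvv' : q v v = \sum_i \sum_j A y j i * (v 0 i * v 0 j).
    rewrite qvv exchange_big /=; apply: eq_bigr => i _; apply: eq_bigr => j _.
    by rewrite [v 0 i * _]mulrC.
  rewrite (_ : q v v = 2^-1 * (q v v + q v v)); last by field.
  rewrite {1}qvv qvv' -big_split mulr_sumr; apply: eq_bigr => i _ /=.
  rewrite -big_split mulr_sumr; apply: eq_bigr => j _ /=; rewrite pE; ring.
rewrite lE; apply: eq_bigr => i _.
by rewrite mulr1 !LE' qN lN ld; field.
Qed.

Lemma expands_lin (a : R) L L' : expands L -> expands L' ->
  expands (fun y v => a * L y v + L' y v).
Proof.
move=> eL eL' y v; rewrite eL eL' mulr_sumr -big_split; apply: eq_bigr => i _ /=.
rewrite mulrA -mulrDl; congr (_ * _).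
case: i => [[i j]|[i|u]] /=; rewrite /polar //; ring.
Qed.

Lemma coef_C2 L i : C2 (fun q : 'rV[R]_n * 'rV[R]_n => L q.1 q.2) -> C2 (coef L i).
Proof.
move=> C2L.
have C2v v : C2 (fun y => L y v).
  exact: (C2_affine (is_diff_pair_l v) C2L).
case: i => [[i j]|[i|u]] /=; last exact: C2v.
- rewrite (_ : coef L (inl (i, j)) =
      2^-1 *: (fun y => L y (delta_mx 0 i + delta_mx 0 j)) +
      (- 2^-1 *: (fun y => L y (delta_mx 0 i)) +
      (- 2^-1 *: (fun y => L y (delta_mx 0 j)) +
      (- 2^-1 *: (fun y => L y 0) + (fun y => L y 0))))).
    exact: (C2_lin _ (C2v _) (C2_lin _ (C2v _) (C2_lin _ (C2v _)
      (C2_lin _ (C2v _) (C2v _))))).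
  apply/funext => y; rewrite /= /polar.
  rewrite -[RHS]/(2^-1 * _ + (- 2^-1 * _ + (- 2^-1 * _ + (- 2^-1 * _ + _)))).
  by field.
- rewrite (_ : coef L (inr (inl i)) =
      2^-1 *: (fun y => L y (delta_mx 0 i)) +
      (- (2^-1 + 1) *: (fun y => L y (- delta_mx 0 i)) +
      (fun y => L y (- delta_mx 0 i)))).
    exact: (C2_lin _ (C2v _) (C2_lin _ (C2v _) (C2v _))).
  apply/funext => y /=; rewrite -[RHS]/(2^-1 * _ + (- (2^-1 + 1) * _ + _)).
  by field.
Qed.

Lemma derive_quadratic (q : 'rV[R]_n -> R) v u (b c : R) :
  (forall s, q (s *: u + v) = q v + s * b + s ^+ 2 * c) -> 'D_u q v = b.
Proof.
move=> qE; apply: cvg_lim => //.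
apply/cvgrPdist_le => e e0; near=> h.
have h0 : h != 0 by near: h; exact: nbhs_dnbhs_neq.
rewrite /= qE.
rewrite -[_ *: _]/(h^-1 * _) (_ : b - _ = - (h * c)); last by field.
rewrite normrN normrM (@le_trans _ _ (`|h| * (`|c| + 1)))//.
  by rewrite ler_wpM2l// lerDl.
rewrite -ler_pdivlMr ?ltr_wpDl//; near: h; apply: dnbhs0_le.
by rewrite divr_gt0// ltr_wpDl.
Unshelve. all: by end_near. Qed.

(** The Hessian in v is the matrix of the quadratic part. *)
Lemma hess_vE L y v : expands L -> hess_v L y v = \matrix_(a, b) polar L a b y.
Proof.
move=> eL.
pose S (u w : 'rV[R]_n) := \sum_a \sum_b polar L a b y * (u 0 a * w 0 b).
pose l (u : 'rV[R]_n) := \sum_a coef L (inr (inl a)) y * u 0 a.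
have LE w : L y w = 2^-1 * S w w + l w + L y 0.
  rewrite {1}eL sum_monomial /= !mulr1 addrA; congr (_ + _ + _).
    rewrite /S mulr_sumr; apply: eq_bigr => a _; rewrite mulr_sumr.
    by apply: eq_bigr => b _; rewrite -mulrA.
  by apply: eq_bigr => a _; rewrite mulr1.
have pC a b : polar L a b y = polar L b a y.
  by rewrite /polar [delta_mx 0 a + _]addrC; ring.
have SC u w : S u w = S w u.
  rewrite /S exchange_big /=; apply: eq_bigr => a _; apply: eq_bigr => b _.
  by rewrite pC [_ * w 0 _]mulrC.
have Slin s u u' w : S (s *: u + u') w = s * S u w + S u' w.
  rewrite /S mulr_sumr -big_split; apply: eq_bigr => a _ /=.
  rewrite mulr_sumr -big_split; apply: eq_bigr => b _ /=.
  by rewrite !mxE; ring.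
have llin s u u' : l (s *: u + u') = s * l u + l u'.
  rewrite /l mulr_sumr -big_split; apply: eq_bigr => a _ /=.
  by rewrite !mxE; ring.
have D1 u w : 'D_u (L y) w = S u w + l u.
  apply: (@derive_quadratic _ _ _ _ (2^-1 * S u u)) => s.
  rewrite (LE (s *: u + w)) (LE w) Slin !(SC _ (s *: u + w)) !Slin llin (SC w u).
  by field.
have Sd a b : S (delta_mx 0 a) (delta_mx 0 b) = polar L a b y.
  rewrite /S (bigD1 a)//= (bigD1 b)//= !mxE !eqxx /= !mulr1.
  rewrite big1 ?addr0 => [|b' bb']; last first.
    by rewrite !mxE (negPf bb') /= !mulr0.
  rewrite big1 ?addr0// => a' aa'; rewrite big1// => b' _.
  by rewrite !mxE (negPf aa') /= mul0r mulr0.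
apply/matrixP => a b; rewrite !mxE.
rewrite (_ : 'D_('e_b) (L y) = fun w => S (delta_mx 0 b) w + l (delta_mx 0 b)); last first.
  by apply/funext => w; exact: D1.
rewrite (@derive_quadratic _ _ _ (polar L a b y) 0)// => s.
by rewrite (SC _ (s *: _ + _)) Slin Sd (SC v); ring.
Qed.

End Coefficients.

(** * The action functional *)

Lemma integral_lincomb (R : realType) (I : Type) (r : seq I) (k : I -> R)
    (F : I -> R -> R) :
  (forall i, mu.-integrable I01 (EFin \o F i)) ->
  mu.-integrable I01 (EFin \o (fun t => \sum_(i <- r) k i * F i t)) /\
  \int[mu]_(t in I01) (\sum_(i <- r) k i * F i t) =
    \sum_(i <- r) k i * \int[mu]_(t in I01) F i t.
Proof.
move=> Fi; elim: r => [|i r [IHi IH]].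
  rewrite big_nil; have e0 : (fun t : R => \sum_(i <- [::]) k i * F i t) = cst 0.
    by apply/funext => t; rewrite big_nil.
  rewrite e0; split; first exact: integrable_cst01.
  by rewrite Rintegral_cst ?mul0r//; exact: measurable_I01.
have es : (fun t => \sum_(j <- i :: r) k j * F j t) =
    (fun t => k i * F i t + \sum_(j <- r) k j * F j t).
  by apply/funext => t; rewrite big_cons.
have ki : mu.-integrable I01 (EFin \o (fun t => k i * F i t)).
  by apply: integrableZl_EFin; [exact: measurable_I01|exact: Fi].
rewrite es big_cons; split.
  rewrite (_ : _ \o _ = (EFin \o (fun t => k i * F i t)%R) \+
      (EFin \o (fun t => \sum_(j <- r) k j * F j t)%R))%E; last exact/funext.
  by apply: integrableD => //; exact: measurable_I01.
rewrite RintegralD//; last exact: measurable_I01.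
by rewrite IH RintegralZl//; exact: measurable_I01.
Qed.

Lemma is_diff_fst (R : realType) (U V : normedModType R) (q : U * V) :
  is_diff q (@fst U V) (@fst U V).
Proof.
pose L : {linear (U * V)%type -> U} :=
  HB.pack (@fst U V) (GRing.isLinear.Build R (U * V)%type U *:%R (@fst U V)
    (fun a x y => erefl)).
have cL : continuous L by move=> x; exact: cvg_fst.
by split; [exact: (@linear_differentiable _ _ _ L q cL)|exact: (@diff_lin _ _ _ L q cL)].
Qed.

Lemma is_diff_snd (R : realType) (U V : normedModType R) (q : U * V) :
  is_diff q (@snd U V) (@snd U V).
Proof.
pose L : {linear (U * V)%type -> V} :=
  HB.pack (@snd U V) (GRing.isLinear.Build R (U * V)%type V *:%R (@snd U V)
    (fun a x y => erefl)).
have cL : continuous L by move=> x; exact: cvg_snd.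
by split; [exact: (@linear_differentiable _ _ _ L q cL)|exact: (@diff_lin _ _ _ L q cL)].
Qed.

Section ActionBlocks.
Context {R : realType} {n : nat}.
Implicit Types (L : 'rV[R]_n -> 'rV[R]_n -> R) (p : W12 R n * R).

(** The L^2 factor that a variable of a monomial contributes, and its linear part. *)
Definition slot (o : option 'I_n) : W12 R n -> R -> R :=
  if o is Some a then fun x t => weak_derivative x t 0 a else fun=> cst 1.

Definition slot0 (o : option 'I_n) : W12 R n -> R -> R :=
  if o is Some a then fun x t => weak_derivative x t 0 a else fun=> cst 0.

Lemma affine_L2_slot o : affine_L2 (slot o) (slot0 o).
Proof.
by case: o => [a|]; [exact: affine_L2_deriv|exact/affine_L2_cst/sqint_cst].
Qed.

Definition mblock L (i : monomial) : W12 R n -> R :=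
  block (coef L i) (cst 1) (slot (slot1 i)) (slot (slot2 i)).

Lemma continuous_cst1 : {within @I01 R, continuous (cst 1 : R -> R)}.
Proof. by apply: continuous_subspaceT => t; exact: cvg_cst. Qed.

Section Lagrangian.
Variable L : 'rV[R]_n -> 'rV[R]_n -> R.
Hypotheses (eL : expands L) (C2L : C2 (fun q : 'rV[R]_n * 'rV[R]_n => L q.1 q.2)).

Let C1c i : C1 (coef L i). Proof. exact: (coef_C2 i C2L).1. Qed.

Lemma Lagrangian_integral (x : W12 R n) (s : R) :
  mu.-integrable I01 (EFin \o (fun t => L (x t) (s *: weak_derivative x t))) /\
  \int[mu]_(t in I01) L (x t) (s *: weak_derivative x t) =
    \sum_i s ^+ degree i * mblock L i x.
Proof.
pose F i t := coef L i (x t) * cst 1 t * slot (slot1 i) x t * slot (slot2 i) x t.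
have -> : (fun t => L (x t) (s *: weak_derivative x t)) =
    (fun t => \sum_i s ^+ degree i * F i t).
  apply/funext => t; rewrite eL; apply: eq_bigr => -[[a b]|[a|u]] _;
    rewrite /F /= ?mxE; ring.
apply: integral_lincomb => i; apply: sqint_mul.
  apply: sqint_mul_continuous; last exact: affine_L2_sqint (affine_L2_slot _) x.
  have c1 := @continuous_weight _ _ _ x (C1_continuous (C1c i)).
  exact: (continuousM_I01 c1 continuous_cst1).
exact: affine_L2_sqint (affine_L2_slot _) x.
Qed.

(** The identity holds for every T, including T = 0, because the factor T stays
    outside. *)
Lemma action_funE p :
  action_fun L p = p.2 * \sum_i p.2^-1 ^+ degree i * mblock L i p.1.
Proof. by rewrite /action_fun (Lagrangian_integral _ _).2. Qed.

Lemma twice_diff_mblock i x : twice_diff (mblock L i) x.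
Proof.
exact: (twice_diff_block (coef_C2 i C2L) continuous_cst1 (affine_L2_slot _)
  (affine_L2_slot _) x).1.
Qed.

Lemma twice_diff_action p : p.2 != 0 -> twice_diff (action_fun L) p.
Proof.
move=> p0.
have tsnd : twice_diff (@snd (W12 R n) R) p.
  have [|h|//] := @twice_diff_intro _ _ (@snd (W12 R n) R) (fun=> snd) p.
    by near=> q; exact: is_diff_snd.
  exact: differentiable_cst.
have tinv : twice_diff (fun q : W12 R n * R => q.2^-1) p.
  have tt : twice_diff (@GRing.inv R) (snd p) by exact: twice_diff_inv.
  exact: (twice_diff_affine (@is_diff_snd R (W12 R n) R) tt).1.
have tpow k : twice_diff (fun q : W12 R n * R => q.2^-1 ^+ k) p.
  elim: k => [|k IH]; first exact: (twice_diff_cst 1 p).1.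
  rewrite (_ : (fun q : W12 R n * R => _) =
    (fun q : W12 R n * R => q.2^-1) * (fun q : W12 R n * R => q.2^-1 ^+ k)).
    exact: twice_diffM.
  by apply/funext => q; rewrite exprS.
have tblock i : twice_diff (fun q : W12 R n * R => mblock L i q.1) p.
  exact: (twice_diff_affine (@is_diff_fst R (W12 R n) R)
    (twice_diff_mblock i (fst p))).1.
rewrite (_ : action_fun L = (@snd (W12 R n) R) * \sum_i
    ((fun q : W12 R n * R => q.2^-1 ^+ degree i) *
     (fun q : W12 R n * R => mblock L i q.1))).
  apply: (twice_diffM tsnd).
  exact: (twice_diff_sum (index_enum _) (fun i => twice_diffM (tpow _) (tblock i))).1.
apply/funext => q; rewrite action_funE; congr (_ * _).
by rewrite fct_sumE.
Unshelve. all: by end_near. Qed.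

Lemma Legendre c y (w : 'rV[R]_n) : mx_ge (hess_v L y 0) c ->
  \sum_a c * (w 0 a * w 0 a) <= \sum_a \sum_b polar L a b y * (w 0 a * w 0 b).
Proof.
move=> /(_ w); rewrite hess_vE// !mxE => h.
apply: le_trans (le_trans _ h) _.
  rewrite -mulr_sumr le_eqVlt; apply/orP; left; apply/eqP; congr (_ * _).
  by apply: eq_bigr => a _; rewrite mxE.
rewrite exchange_big /= le_eqVlt; apply/orP; left; apply/eqP.
apply: eq_bigr => b _; rewrite !mxE mulr_suml; apply: eq_bigr => a _.
by rewrite !mxE; ring.
Qed.

(** Garding's inequality for the second variation along (xi, 0). *)
Lemma action_coercive c (x : W12 R n) (T : R) : 0 < T ->
  (forall y, mx_ge (hess_v L y 0) c) ->
  exists2 C, 0 <= C & forall (xi : W12 R n) (d : R), 0 <= d <= 1 ->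
    (forall t, `|xi t| <= d * `|xi|) ->
    c / T * \sum_i L2norm (fun t => weak_derivative xi t 0 i) ^+ 2
      - C * (d * `|xi| ^+ 2) <= diff2 (action_fun L) (x, T) (xi, 0) (xi, 0).
Proof.
move=> T0 hc; have T0' : T != 0 by rewrite gt_eqF.
pose k (i : @monomial n) := T * T^-1 ^+ degree i.
pose S i := twice_diffZ (k i) (twice_diff_mblock i x).
have d2E (xi : W12 R n) : diff2 (action_fun L) (x, T) (xi, 0) (xi, 0) =
    \sum_i k i * diff2 (mblock L i) x xi xi.
  have tw : twice_diff (action_fun L) (x, T) by exact: twice_diff_action.
  have [_ <-] := twice_diff_affine (g := fun y => (y, T)) (p := x)
    (is_diff_pair_l T) tw.
  have -> : action_fun L \o (fun y => (y, T)) = \sum_i k i *: mblock L i.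
    apply/funext => y; rewrite /= action_funE fct_sumE mulr_sumr.
    by apply: eq_bigr => i _; rewrite mulrA.
  rewrite (twice_diff_sum (index_enum _) (fun i => (S i).1)).2.
  by apply: eq_bigr => i _; rewrite (S i).2.
pose Pr i (xi : W12 R n) := 2 * tri (fun t => coef L i (x t) * cst 1 t)
  (slot0 (slot1 i) xi) (slot0 (slot2 i) xi).
have /all_sig2[C C0 CP] i : {C : R | 0 <= C & forall (xi : W12 R n) (d : R), 0 <= d <= 1 ->
    (forall t, `|xi t| <= d * `|xi|) ->
    `|diff2 (mblock L i) x xi xi - Pr i xi| <= C * (d * `|xi| ^+ 2)}.
  apply/cid2.
  have [D D0 DP] := d2block_principal (coef_C2 i C2L) continuous_cst1
    (affine_L2_slot (slot1 i)) (affine_L2_slot (slot2 i)) x.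
  exists D => // xi d d01 xid.
  have := (twice_diff_block (coef_C2 i C2L) continuous_cst1
    (affine_L2_slot (slot1 i)) (affine_L2_slot (slot2 i)) x).2 xi xi.
  by rewrite -/(mblock L i) => ->; exact: DP.
have k0 i : 0 <= k i by rewrite mulr_ge0 ?exprn_ge0 ?invr_ge0 ?ltW.
exists (\sum_i k i * C i) => [|xi d d01 xid].
  by apply: sumr_ge0 => i _; rewrite mulr_ge0.
rewrite d2E.
suff pr : c / T * \sum_i L2norm (fun t => weak_derivative xi t 0 i) ^+ 2 <=
    \sum_i k i * Pr i xi.
  apply: (le_trans (lerB pr (lexx _))).
  rewrite mulr_suml -sumrB; apply: ler_sum => i _.
  rewrite (_ : _ - _ = k i * (Pr i xi - C i * (d * `|xi| ^+ 2))); last by ring.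
  rewrite ler_wpM2l//.
  by have := CP i xi d d01 xid; rewrite ler_norml => /andP[+ _]; lra.
have tri0 m u : tri m u (cst 0) = 0 :> R.
  by rewrite triC /tri -[RHS](ip0l u); apply: eq_Rintegral => t _; rewrite mulr0.
(* Only the monomials of degree 2 have two nonconstant slots. *)
rewrite sum_monomial /Pr /= tri0 !mulr0 addr0 [X in _ + X]big1 ?addr0; last first.
  by move=> a _; rewrite tri0 !mulr0.
pose v := weak_derivative xi.
have Lv a : sq_integrable (fun t => v t 0 a) by exact: weak_derivative_sqint.
pose F (ab : 'I_n * 'I_n) t :=
  coef L (inl ab) (x t) * cst 1 t * v t 0 ab.1 * v t 0 ab.2.
have Fi ab : mu.-integrable I01 (EFin \o F ab).
  apply: sqint_mul => //; apply: sqint_mul_continuous => //.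
  have c1 := @continuous_weight _ _ _ x (C1_continuous (C1c (inl ab))).
  exact: (continuousM_I01 c1 continuous_cst1).
have [Ii IE] := integral_lincomb (index_enum _) (fun=> 2 / T) Fi.
have [Ji JE] := integral_lincomb (index_enum _) (fun=> c / T)
  (fun a => sqint_mul (Lv a) (Lv a)).
rewrite pair_bigA /=.
rewrite (eq_bigr (fun ab : 'I_n * 'I_n => 2 / T * \int[mu]_(t in I01) F ab t)); last first.
  move=> [a b] _; rewrite /k /= -[tri _ _ _]/(\int[mu]_(t in I01) F (a, b) t).
  by field.
rewrite -IE mulr_sumr (eq_bigr (fun a => c / T * \int[mu]_(t in I01) (v t 0 a * v t 0 a)));
  last by move=> a _; rewrite sqr_L2norm.
rewrite -JE; apply: le_Rintegral => // [|t _]; first exact: measurable_I01.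
have := Legendre (v t) (hc (x t)); rewrite pair_bigA /=.
have Ti : 0 <= T^-1 by rewrite invr_ge0 ltW.
move=> /(ler_wpM2l Ti); rewrite !mulr_sumr => h.
apply: le_trans (le_trans _ h) _.
  by rewrite le_eqVlt; apply/orP; left; apply/eqP; apply: eq_bigr => a _; ring.
rewrite le_eqVlt; apply/orP; left; apply/eqP; apply: eq_bigr => -[a b] _.
by rewrite /F /=; field.
Qed.

End Lagrangian.
End ActionBlocks.

(** * The path of critical points *)

Section Path.
Context {R : realType}.

Lemma segment_within_proper (a b s : R) : a < b -> a <= s <= b ->
  ProperFilter (within `[a, b] s^').
Proof.
move=> ab /andP[as_ sb]; apply: Build_ProperFilter_ex => P.
move=> /nbhs_ballP[r /= r0 rP].
have near_s t : `|s - t| < r -> t != s -> a <= t <= b -> P t.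
  by move=> tr ts tab; apply: rP => //=; rewrite in_itv.
have [sb'|bs] := ltP s b.
  have m0 : 0 < Num.min (r / 2) (b - s) by rewrite lt_min divr_gt0// subr_gt0.
  exists (s + Num.min (r / 2) (b - s)); apply: near_s.
  - rewrite opprD addrA subrr sub0r normrN gtr0_norm// gt_min; apply/orP; left.
    by rewrite ltr_pdivrMr// ltr_pMr// ltr1n.
  - by rewrite gt_eqF// ltrDl.
  - have : Num.min (r / 2) (b - s) <= b - s by rewrite ge_min lexx orbT.
    by move=> ?; apply/andP; split; lra.
have m0 : 0 < Num.min (r / 2) (b - a) by rewrite lt_min divr_gt0// subr_gt0.
exists (s - Num.min (r / 2) (b - a)); apply: near_s.
- rewrite opprB addrC subrK gtr0_norm// gt_min; apply/orP; left.
  by rewrite ltr_pdivrMr// ltr_pMr// ltr1n.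
- by rewrite lt_eqF// ltrBlDr ltrDl.
- have : Num.min (r / 2) (b - a) <= b - a by rewrite ge_min lexx orbT.
  by move=> ?; apply/andP; split; lra.
Qed.

Lemma diff_quot_in_cvg (V : normedModType R) (D : set R) (q : R -> V) (s : R) (v : V) :
  diff_quot_in D q s --> v -> q t @[t --> within D s^'] --> q s.
Proof.
rewrite /diff_quot_in => qv; set A := within D s^'.
have FA : Filter A by exact: within_filter.
have As : (t @[t --> A]) --> s.
  by apply: cvg_trans (@cvg_within _ s^' _ D) _; exact: nbhs_dnbhs.
have h : (q s + (t - s) *: ((t - s)^-1 *: (q t - q s)) @[t --> A]) --> q s + 0 *: v.
  apply: cvgD; first exact: cvg_cst.
  by apply: cvgZ => //; rewrite -(subrr s); apply: cvgB => //; exact: cvg_cst.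
rewrite scale0r addr0 in h; apply: cvg_trans h; apply: near_eq_cvg.
have Aneq : \forall t \near A, t != s.
  by apply: (@cvg_within _ s^' _ D); exact: (@nbhs_dnbhs_neq R s).
near=> t; rewrite scalerA divff ?scale1r ?subrKC//.
by rewrite subr_eq0; near: t.
Unshelve. all: by end_near. Qed.

End Path.

Section PencilSetup.
Context {R : realType} {n : nat}.

Lemma evaluation_is_diff (t : R) i (p : W12 R n * R) :
  is_diff p (fun h : W12 R n * R => h.1 t 0 i) (fun h : W12 R n * R => h.1 t 0 i).
Proof.
apply: (is_diff_from_bound (K := 3)) => [a h k|h|e e0].
- by rewrite -[(a *: h + k).1 t]/(a *: h.1 t + k.1 t) !mxE.
- rewrite (le_trans (rV_coord_le _ i))// (le_trans (W12_sup_le _ t))//.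
  by rewrite ler_pM2l// le_max lexx.
- exists 1 => // h _.
  rewrite -[(p + h).1 t]/(p.1 t + h.1 t) mxE.
  rewrite [X in `|X|](_ : _ = 0) ?normr0 ?mulr_ge0 ?(ltW e0)//.
  by rewrite addrAC addrK subrr.
Qed.

Variables (L1 L2 : 'rV[R]_n -> 'rV[R]_n -> R) (sigma0 sigma1 : R).
Hypotheses (sigma01 : sigma0 < sigma1).
Hypothesis L_C2 : forall sigma, sigma0 <= sigma <= sigma1 ->
    C2 (fun q : 'rV[R]_n * 'rV[R]_n => pencil L1 L2 sigma q.1 q.2).
Hypothesis L_quadratic : forall sigma, sigma0 <= sigma <= sigma1 ->
    quadratic_in_v (pencil L1 L2 sigma).

Let I0 : sigma0 <= sigma0 <= sigma1. Proof. by rewrite lexx ltW. Qed.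
Let I1 : sigma0 <= sigma1 <= sigma1. Proof. by rewrite lexx ltW. Qed.
Let w := (sigma1 - sigma0)^-1.
Let w_neq0 : sigma1 - sigma0 != 0. Proof. by rewrite subr_eq0 gt_eqF. Qed.

(** Only the members of the pencil with parameter in [sigma0, sigma1] are known to be
    regular, so L1 and L2 are expressed by the two extreme ones. *)
Lemma pencil_slope y v : L2 y v = w * pencil L1 L2 sigma1 y v +
  ((- w - 1) * pencil L1 L2 sigma0 y v + pencil L1 L2 sigma0 y v).
Proof. by rewrite /pencil /w; field. Qed.

Lemma expands_slope : expands L2.
Proof.
have e0 := quadratic_expands (L_quadratic I0).
have e1 := quadratic_expands (L_quadratic I1).
have := expands_lin w e1 (expands_lin (- w - 1) e0 e0).
by congr expands; apply/funext => y; apply/funext => v; rewrite pencil_slope.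
Qed.

Lemma C2_slope : C2 (fun q : 'rV[R]_n * 'rV[R]_n => L2 q.1 q.2).
Proof.
have := C2_lin w (L_C2 I1) (C2_lin (- w - 1) (L_C2 I0) (L_C2 I0)).
by congr C2; apply/funext => q; rewrite pencil_slope.
Qed.

Lemma expands_origin : expands L1.
Proof.
have := expands_lin (- sigma0) expands_slope (quadratic_expands (L_quadratic I0)).
by congr expands; apply/funext => y; apply/funext => v; rewrite /pencil; ring.
Qed.

Lemma C2_origin : C2 (fun q : 'rV[R]_n * 'rV[R]_n => L1 q.1 q.2).
Proof.
have := C2_lin (- sigma0) C2_slope (L_C2 I0).
congr C2; apply/funext => q.
by rewrite -[LHS]/(- sigma0 * L2 q.1 q.2 + pencil L1 L2 sigma0 q.1 q.2) /pencil; ring.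
Qed.

Lemma action_pencilE s : action_pencil L1 L2 s = action_fun (pencil L1 L2 s).
Proof.
apply/funext => p; rewrite /action_pencil /action_fun mulrCA -mulrDr; congr (_ * _).
have [i1 _] := Lagrangian_integral expands_origin C2_origin p.1 p.2^-1.
have [i2 _] := Lagrangian_integral expands_slope C2_slope p.1 p.2^-1.
rewrite -RintegralZl//; last exact: measurable_I01.
rewrite -RintegralD//; first exact: measurable_I01.
by apply: integrableZl_EFin => //; exact: measurable_I01.
Qed.

End PencilSetup.

Section Kernel.
Context {R : realType} {n : nat}.
Variables (L : 'rV[R]_n -> 'rV[R]_n -> R) (c : R) (x : W12 R n) (T : R).
Hypotheses (eL : expands L) (C2L : C2 (fun q : 'rV[R]_n * 'rV[R]_n => L q.1 q.2)).
Hypotheses (c0 : 0 < c) (hc : forall y, mx_ge (hess_v L y 0) c) (T0 : 0 < T).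

Lemma variations_subspace : is_subspace (@Defs.variations R n).
Proof.
split; first by split.
move=> a h k [h0 h1] [k0 k1]; split.
- by rewrite -[(a *: h + k).1 0]/(a *: h.1 0 + k.1 0) h0 k0 scaler0 addr0.
- by rewrite -[(a *: h + k).1 1]/(a *: h.1 1 + k.1 1) h1 k1 scaler0 addr0.
Qed.

(** A vector (xi, b) of the kernel is isotropic, so by coercivity it vanishes as soon
    as b = 0 and xi vanishes at sufficiently many sample points. *)
Lemma ker_diff2_has_dim : exists d, has_dim (ker_diff2 (action_fun L) (x, T)) d.
Proof.
have tw : twice_diff (action_fun L) (x, T).
  by apply: twice_diff_action => //=; rewrite gt_eqF.
have [C C0 coer] := action_coercive eL C2L x T0 hc.
have [m mP] := coercive_sampled_eq0 (divr_gt0 c0 T0) C0 coer.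
apply: (@has_dim_embedding _ _ _ _ (@samples R n m)).
- apply: (radical_subspace variations_subspace (B := diff2 (action_fun L) (x, T))).
  exact: diff2_linl.
- exact: samples_linear.
move=> [xi b] [Xh Kh] /samples_eq0[/= b0 xi0]; rewrite b0 in Xh Kh *.
by rewrite (mP xi xi0)//; exact: Kh.
Qed.

End Kernel.

Section CriticalPath.
Context {R : realType} {V : normedModType R}.
Variables (X : set V) (F G : V -> R) (p : R -> V) (a b s : R) (v : V).
Hypotheses (ab : a < b) (sab : a <= s <= b).
Hypotheses (pv : diff_quot_in `[a, b] p s --> v).
Hypotheses (Fp : forall t, a <= t <= b -> differentiable F (p t)).
Hypotheses (Gp : forall t, a <= t <= b -> differentiable G (p t)).
Hypotheses (FF : twice_diff F (p s)) (GG : twice_diff G (p s)).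
Hypothesis crit : forall t h, a <= t <= b -> X h ->
  'd (F + (t - s) *: G) (p t) h = 0.

(** Differentiate d(F + (t - s) G)(p_t) h = 0 at t = s: by criticality, d F(p_t) h is
    - (t - s) d G(p_t) h, whose difference quotient is - d G(p_t) h. *)
Lemma critical_path_equation h : X h -> diff2 F (p s) h v = - 'd G (p s) h.
Proof.
move=> Xh; have AP := segment_within_proper ab sab.
have Fh t : a <= t <= b -> 'd F (p t) h = - ((t - s) * 'd G (p t) h).
  move=> tab; have := crit tab Xh.
  have dE : is_diff (p t) (F + (t - s) *: G)
      (('d F (p t) : V -> R) + (t - s) *: ('d G (p t) : V -> R)).
    by apply: is_diffD; [|apply: is_diffZ]; apply: differentiableP;
      [exact: Fp|exact: Gp].
  by rewrite (@diff_val _ _ _ _ _ _ _ dE) => /eqP; rewrite addr_eq0 => /eqP.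
have l1 := diff_lim_quot pv (FF.2 h).
have l2 : ('d G (p t) h @[t --> within `[a, b] s^']) --> 'd G (p s) h.
  have ct := differentiable_continuous (GG.2 h).
  exact: (continuous_cvg _ ct (diff_quot_in_cvg pv)).
have l3 : (- 'd G (p t) h @[t --> within `[a, b] s^']) --> - 'd G (p s) h.
  exact: cvgN.
apply: etrans (esym (cvg_lim (@norm_hausdorff _ _) l1)) _; apply: cvg_lim => //.
apply: cvg_trans l3; apply: near_eq_cvg.
have Aneq : \forall t \near within `[a, b] s^', t != s.
  by apply: (@cvg_within _ s^' _ `[a, b]%classic); exact: (@nbhs_dnbhs_neq R s).
have AD : \forall t \near within `[a, b] s^', t \in `[a, b].
  by apply: near_withinT.
near=> t.
have ts : t - s != 0 by rewrite subr_eq0; near: t.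
have tab : a <= t <= b by have : t \in `[a, b]; [near: t|rewrite in_itv].
rewrite /= (Fh _ tab) (Fh _ sab) subrr mul0r oppr0 subr0.
by rewrite scalerN -[_ *: _]/(_ * _) mulKf.
Unshelve. all: by end_near. Qed.

End CriticalPath.

Theorem lemma3p5 (R : realType) (n : nat) (xm xp : 'rV[R]_n)
  (L1 L2 : 'rV[R]_n -> 'rV[R]_n -> R) (c sigma0 sigma1 : R)
  (x : R -> W12 R n) (T : R -> R)
  (sigma0_ge0 : 0 <= sigma0) (sigma01 : sigma0 < sigma1) (c_gt0 : 0 < c)
  (L_C2 : forall sigma, sigma0 <= sigma <= sigma1 ->
    C2 (fun q : 'rV[R]_n * 'rV[R]_n => pencil L1 L2 sigma q.1 q.2))
  (L_quadratic : forall sigma, sigma0 <= sigma <= sigma1 ->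
    quadratic_in_v (pencil L1 L2 sigma))
  (L_convex : forall sigma, sigma0 <= sigma <= sigma1 ->
    forall q v, mx_ge (hess_v (pencil L1 L2 sigma) q v) c)
  (x_bd : forall sigma, sigma0 <= sigma <= sigma1 -> W12bd xm xp (x sigma))
  (T_gt0 : forall sigma, sigma0 <= sigma <= sigma1 -> 0 < T sigma)
  (xT_C1 : C1_path `[sigma0, sigma1] (fun sigma => (x sigma, T sigma)))
  (xT_critical : forall sigma, sigma0 <= sigma <= sigma1 ->
    is_critical (action_pencil L1 L2 sigma) (x sigma, T sigma)) :
  forall sigma, sigma0 <= sigma <= sigma1 ->
  let n_ := frak_n L1 L2 sigma (x sigma, T sigma) in
  let a : R := derive_in `[sigma0, sigma1] (fun s => action_fun L2 (x s, T s)) sigma in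
  [/\ n_ = 0%E \/ n_ = 1%E,
      a <> 0 -> n_ = m_plus a,
      ~ is_critical (action_fun L2) (x sigma, T sigma) -> a = 0 -> n_ = 1%E &
      (0 <= n_ - m_plus a)%E /\ (n_ = 0%E -> n_ - m_plus a = 0)%E].
Proof.
move=> s sI n_ a.
pose p t := (x t, T t).
pose X : set (W12 R n * R) := @Defs.variations R n.
pose F := action_pencil L1 L2 s; pose G := action_fun L2.
have sD : `[sigma0, sigma1]%classic s by rewrite /= in_itv.
have AP := segment_within_proper sigma01 sI.
have Tneq0 t : sigma0 <= t <= sigma1 -> (p t).2 != 0.
  by move=> tI; exact: lt0r_neq0 (T_gt0 t tI).
have FE : F = action_fun (pencil L1 L2 s) by exact: (action_pencilE sigma01 L_C2 L_quadratic).
have eF := quadratic_expands (L_quadratic _ sI).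
have eG := expands_slope sigma01 L_quadratic.
have C2G := C2_slope sigma01 L_C2.
have tF t : sigma0 <= t <= sigma1 -> twice_diff F (p t).
  by move=> tI; rewrite FE; exact: (twice_diff_action eF (L_C2 _ sI) (Tneq0 _ tI)).
have tG t : sigma0 <= t <= sigma1 -> twice_diff G (p t).
  by move=> tI; exact: (twice_diff_action eG C2G (Tneq0 _ tI)).
have dF t (tI : sigma0 <= t <= sigma1) := twice_diff_differentiable (tF t tI).
have dG t (tI : sigma0 <= t <= sigma1) := twice_diff_differentiable (tG t tI).
pose v := lim (diff_quot_in `[sigma0, sigma1] p s).
have pv : diff_quot_in `[sigma0, sigma1] p s --> v by exact: (xT_C1.1 s sD).
(* The end points are fixed along the path, so its velocity is a variation. *)
have ev t (y : 'rV[R]_n) : (forall u, sigma0 <= u <= sigma1 -> x u t = y) -> v.1 t = 0.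
  move=> xt; apply/rowP => i; rewrite [RHS]mxE.
  have [de dv] := evaluation_is_diff t i (p s).
  have l := diff_lim_quot pv de; rewrite dv in l.
  apply: etrans (esym (cvg_lim (@norm_hausdorff _ _) l)) _; apply: cvg_lim => //.
  have l0 : (cst (0 : R) t0 @[t0 --> within `[sigma0, sigma1] s^']) --> (0 : R).
    exact: cvg_cst.
  apply: cvg_trans l0; apply: near_eq_cvg.
  have AD : \forall u \near within `[sigma0, sigma1] s^', u \in `[sigma0, sigma1].
    by apply: near_withinT.
  near=> u.
  have uI : sigma0 <= u <= sigma1.
    by have : u \in `[sigma0, sigma1]; [near: u|rewrite in_itv].
  by rewrite /= !xt// subrr scaler0.
have Xv : X v.
  by split; [apply: (ev 0 xm) => u /x_bd[]|apply: (ev 1 xp) => u /x_bd[]].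
have crit t h : sigma0 <= t <= sigma1 -> X h -> 'd (F + (t - s) *: G) (p t) h = 0.
  move=> tI Xh; rewrite -(xT_critical t tI h Xh); congr ('d _ _ h).
  apply/funext => q.
  rewrite -[LHS]/(action_fun L1 q + s * action_fun L2 q + (t - s) * action_fun L2 q).
  by rewrite /action_pencil; ring.
have key h : X h -> diff2 F (p s) h v = - 'd G (p s) h.
  exact: (critical_path_equation sigma01 sI pv dF dG (tF s sI) (tG s sI) crit).
(* a = dG(p_s) v, by the chain rule, and the key identity for h = v. *)
have aE : a = - diff2 F (p s) v v.
  rewrite key// opprK.
  exact: (cvg_lim (@norm_hausdorff _ _) (diff_lim_quot pv (dG s sI))).
have hK : exists d, has_dim (ker_diff2 F (p s)) d.
  rewrite FE; apply: (ker_diff2_has_dim _ eF (L_C2 _ sI) c_gt0 _ (T_gt0 _ sI)).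
  by move=> y; exact: L_convex.
have [d Kd] := hK.
have HE : [set h | X h /\ diff2 F (p s) h v = 0] = ker_diff G (p s).
  apply/seteqP; split=> h [Xh hv]; split=> //; move: hv; rewrite key//.
    by move=> /eqP; rewrite oppr_eq0 => /eqP.
  by rewrite -/X => ->; rewrite oppr0.
have := index_biorthogonal (@variations_subspace R n) Xv (diff2_linl (tF s sI))
  (fun h k => diff2_sym h k (tF s sI)) Kd.
rewrite HE -/(orth_diff2 F (p s) (ker_diff G (p s))) -/(ker_diff2 F (p s)).
rewrite -[LHS]/n_ => nE.
have critE : ~ is_critical G (p s) <-> ~ ker_diff2 F (p s) v.
  split=> nc; apply: contra_not nc.
    move=> [_ Kv] h Xh; have := Kv h Xh; rewrite diff2_sym// ?key//; last exact: tF.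
    by move=> /eqP; rewrite oppr_eq0 => /eqP.
  move=> cr; split=> // k Xk; rewrite diff2_sym; last exact: tF.
  by rewrite key// cr// oppr0.
have nval : n_ = if (0 < a) || (a == 0) && `[< ~ is_critical G (p s) >] then 1%E else 0%E.
  rewrite nE aE oppr_gt0 oppr_eq0; congr (if _ || (_ && _) then _ else _).
  by apply/asboolP/asboolP => /critE.
split.
- by rewrite nval; case: ifP; [right|left].
- by move=> /eqP a0; rewrite nval (negPf a0) orbF /m_plus.
- by move=> nc a0; rewrite nval a0 ltxx eqxx /= asboolT.
- rewrite nval /m_plus; case: (ltP 0 a) => a0 /=; first by rewrite subee.
  by rewrite sube0; split=> //; case: ifP.
Unshelve. all: by end_near. Qed.
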